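(* Let $v_0\in\mathbb R^2$ be not parallel to $v_f=(-1,0)$ (in particular $v_0\neq 0$). Let $x:[0,t_f]\to\mathbb R^2$ be the optimal trajectory of the time-optimal return problem with initial velocity $v_0$: $\dot x=v$, $\dot v=u$, $|u|\le 1$, $x(0)=x(t_f)=0$, $v(0)=v_0$, $v(t_f)=v_f$, $t_f\to\min$. Then the trajectory lies in the angle between the initial velocity and the positive abscissa axis, i.e. $x(t)\in\{a v_0+b(1,0): a,b\ge 0\}$ for all $t\in[0,t_f]$. Moreover, the angle between the position vector $x(t)$ and the positive abscissa axis varies monotonically with time $t\in(0,t_f)$.
   Context: Time-optimal return problem: for a given initial velocity $v_0\in\mathbb R^2$, consider the controlled system $\dot x=v$, $\dot v=u$ with $x,v,u\in\mathbb R^2$ and Euclidean constraint $|u(t)|\le 1$, where admissible controls $u$ are piecewise continuous functions of time. The boundary conditions are $x(0)=0$, $v(0)=v_0$, $x(t_f)=0$, $v(t_f)=v_f=(-1,0)$. The terminal time $t_f$ is to be minimized over admissible controls; its minimum value is the optimal time, a minimizing control is an optimal control, and the corresponding $x(\cdot)$ is the optimal trajectory. The positive abscissa axis is the ray spanned by $(1,0)$. *)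

(* Defs.v *)
From Stdlib Require Import Reals List.
From Coquelicot Require Import Coquelicot.
Open Scope R_scope.

(* Coquelicot's product norm is [sqrt (norm a ^ 2 + norm b ^ 2)], so [norm] on
   [plane] is the Euclidean norm. *)
Definition plane : Type := (R * R)%type.

Definition e1 : plane := (1, 0).
Definition v_f : plane := (-1, 0).

Definition dot (p q : plane) : R := fst p * fst q + snd p * snd q.

(* Linear dependence: the zero vector is parallel to every vector. *)
Definition parallel (p q : plane) : Prop :=
  exists c d : R, (c <> 0 \/ d <> 0) /\ plus (scal c p) (scal d q) = (0, 0).

(* The unoriented angle, in [0, PI]; meaningful only for nonzero vectors. *)
Definition angle (p q : plane) : R := acos (dot p q / (norm p * norm q)).

(* Continuity on [a, b] is one-sided at the end points: functions are total on
   R, but their values outside [a, b] must be irrelevant. *)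
Definition continuous_on_segment (f : R -> plane) (a b : R) : Prop :=
  forall t, a <= t <= b ->
    filterlim f (within (fun s => a <= s <= b) (locally t)) (locally (f t)).

(* Finitely many discontinuities, all with finite one-sided limits. *)
Definition piecewise_continuous (f : R -> plane) (a b : R) : Prop :=
  (exists l : list R, forall t, a < t < b -> ~ In t l -> continuous f t) /\
  (forall t, a <= t < b -> exists y : plane, filterlim f (at_right t) (locally y)) /\
  (forall t, a < t <= b -> exists y : plane, filterlim f (at_left t) (locally y)).

Definition admissible_control (T : R) (u : R -> plane) : Prop :=
  piecewise_continuous u 0 T /\ forall t, 0 <= t <= T -> norm (u t) <= 1.

(* [v] is only piecewise C^1: its derivative is prescribed where [u] is
   continuous, and continuity of [v] rules out jumps elsewhere.  At the end
   points continuity of [x] and [v] makes the one-sided equations redundant. *)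
Record return_process (v0 : plane) (T : R) (u x v : R -> plane) : Prop := {
  rp_time : 0 <= T;
  rp_control : admissible_control T u;
  rp_x_cont : continuous_on_segment x 0 T;
  rp_v_cont : continuous_on_segment v 0 T;
  rp_x_deriv : forall t, 0 < t < T -> is_derive x t (v t);
  rp_v_deriv : forall t, 0 < t < T -> continuous u t -> is_derive v t (u t);
  rp_x_init : x 0 = (0, 0);
  rp_v_init : v 0 = v0;
  rp_x_final : x T = (0, 0);
  rp_v_final : v T = v_f
}.

Definition optimal_return (v0 : plane) (T : R) (u x v : R -> plane) : Prop :=
  return_process v0 T u x v /\
  forall (T' : R) (u' x' v' : R -> plane),
    return_process v0 T' u' x' v' -> T <= T'.

Definition in_angle (p q z : plane) : Prop :=
  exists a b : R, 0 <= a /\ 0 <= b /\ z = plus (scal a p) (scal b q).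

Definition monotone_on_open (f : R -> R) (a b : R) : Prop :=
  (forall s t, a < s -> s <= t -> t < b -> f s <= f t) \/
  (forall s t, a < s -> s <= t -> t < b -> f t <= f s).

(* Main.v *)
Require Import Defs.
From Stdlib Require Import Reals List.
From Stdlib Require Import Lra Psatz ClassicalEpsilon.
From Coquelicot Require Import Coquelicot.
Open Scope R_scope.

(* The maximum principle gives [u = psi / |psi|] with [psi t = a + b t].  It is
   obtained from the dual functional
     [J_T (a, b) = int_0^T |psi| - a . (v_f - v0) - T b . v_f]:
   an interior minimiser of its smoothing (integrand [sqrt (1 + |psi|^2)]) is a
   control reaching the target in time [T], so at times [T' < T] the minimisers
   escape to infinity, and in the limit [J_T (a, b) <= 0] for some
   [(a, b) <> 0], which forces [psi . u = |psi|] for the optimal [u].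

   Since [psi] is affine, each component of [x] along the basis [(v0, e1)] has
   a second derivative changing sign at most once, hence is positive on
   [(0, T)].  Finally [F = x ^ psi] has a third derivative of constant sign and
   [(x ^ v)' = F / |psi|], so [x ^ v], which vanishes at both ends, keeps a
   constant sign; this is the sign of the angular velocity of [x]. *)

(** Along any process ending at time [T], integration by parts gives int psi . u = a . (v_f - v0) +
    T b . v_f. Hence J_T (a, b) = int (|psi| - psi . u) is the gap in a Cauchy-Schwarz inequality:
    it cannot be negative, and where it is zero it fixes [u] wherever psi does not vanish. The
    smoothing is there because |psi| is not differentiable at psi = 0, where psi / |psi| also fails
    to be a continuous control; with sqrt (1 + |psi|^2) stationarity is literally the statement that
    a continuous control hits the target. The equation for [v] holds only off a finite set of times,
    so the sign arguments rest on mean value inequalities that tolerate such a set. *)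

(** * Mean value inequalities and sign arguments for an affine costate *)

(** With corners allowed the mean slope may be attained nowhere, so only an inequality survives.
    Induction on [l] cuts the interval at an exceptional point. *)
Lemma mean_value_le (f df : R -> R) (l : list R) (a b : R) :
  a < b ->
  (forall t, a <= t <= b -> continuous f t) ->
  (forall t, a < t < b -> ~ In t l -> is_derive f t (df t)) ->
  exists c, a < c < b /\ ~ In c l /\ df c * (b - a) <= f b - f a.
Proof.
  revert a b; induction l as [|p l IH]; intros a b Hab Hc Hd.
  - assert (pr1 : forall c, a < c < b -> derivable_pt f c).
    { intros c H; exists (df c); apply is_derive_Reals, Hd; simpl; tauto. }
    destruct (MVT f id a b pr1 (fun c _ => derivable_pt_id c) Hab) as (c & P & E).
    + intros c H; apply continuity_pt_filterlim, Hc, H.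
    + intros; apply derivable_continuous_pt, derivable_pt_id.
    + exists c; split; [exact P|split; [simpl; tauto|]].
      rewrite derive_pt_id, Rmult_1_r in E; unfold id in E.
      rewrite (derive_pt_eq_0 f c (df c) (pr1 c P)) in E.
      * lra.
      * apply is_derive_Reals, Hd; simpl; tauto.
  - destruct (Rlt_dec a p) as [Hap|Hap]; [destruct (Rlt_dec p b) as [Hpb|Hpb]|].
    + destruct (IH a p Hap) as (c1 & H1 & N1 & E1).
      { intros t Ht; apply Hc; lra. }
      { intros t Ht Hn; apply Hd; [lra|]; simpl; intros [H|H]; [lra|tauto]. }
      destruct (IH p b Hpb) as (c2 & H2 & N2 & E2).
      { intros t Ht; apply Hc; lra. }
      { intros t Ht Hn; apply Hd; [lra|]; simpl; intros [H|H]; [lra|tauto]. }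
      (* The mean slope over the whole interval is a convex combination of those over the two
         pieces, so the smaller of the two derivatives works. *)
      destruct (Rle_dec (df c1) (df c2)) as [Hle|Hle];
        [exists c1 | exists c2];
        (split; [lra|split; [simpl; intros [H|H]; [lra|tauto]|nra]]).
    + destruct (IH a b Hab Hc) as (c & H1 & N1 & E1).
      { intros t Ht Hn; apply Hd; [lra|]; simpl; intros [H|H]; [lra|tauto]. }
      exists c; split; [lra|split; [simpl; intros [H|H]; [lra|tauto]|lra]].
    + destruct (IH a b Hab Hc) as (c & H1 & N1 & E1).
      { intros t Ht Hn; apply Hd; [lra|]; simpl; intros [H|H]; [lra|tauto]. }
      exists c; split; [lra|split; [simpl; intros [H|H]; [lra|tauto]|lra]].
Qed.

Lemma mean_value_ge (f df : R -> R) (l : list R) (a b : R) :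
  a < b ->
  (forall t, a <= t <= b -> continuous f t) ->
  (forall t, a < t < b -> ~ In t l -> is_derive f t (df t)) ->
  exists c, a < c < b /\ ~ In c l /\ f b - f a <= df c * (b - a).
Proof.
  intros Hab Hc Hd.
  destruct (mean_value_le (fun t => - f t) (fun t => - df t) l a b Hab) as (c & H & N & E).
  - intros t Ht; apply (continuous_opp f t), Hc, Ht.
  - intros t Ht Hn; apply (is_derive_opp f t (df t)), Hd; assumption.
  - exists c; split; [exact H|split; [exact N|lra]].
Qed.

(* [z' = mu g] with [g] affine: [z] cannot drop to a nonpositive value, come
   back to a nonnegative one and then end at [0], so [w' = z] changes sign
   exactly once and [w] cannot vanish in between. *)
Lemma affine_control_pos (T al be : R) (w z mu : R -> R) (l : list R) :
  (forall t, continuous w t) -> (forall t, continuous z t) ->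
  (forall t, 0 < t < T -> is_derive w t (z t)) ->
  (forall t, 0 < t < T -> ~ In t l -> is_derive z t (mu t * (al + be * t))) ->
  (forall t, 0 < mu t) ->
  w 0 = 0 -> w T = 0 -> 0 < z 0 -> z T = 0 ->
  forall t, 0 < t < T -> 0 < w t.
Proof.
  intros Cw Cz Dw Dz Hmu w0 wT z0 zT t Ht.
  assert (P : forall r s, 0 < r -> r < s -> s < T -> z r <= 0 -> z s < 0).
  { intros r s Hr Hs HT Hz.
    destruct (Rlt_dec (z s) 0) as [|Hn]; [assumption|exfalso].
    set (dz := fun t => mu t * (al + be * t)) in *.
    destruct (mean_value_le z dz l 0 r) as (c1 & H1 & _ & E1); auto.
    { intros; apply Dz; [lra|assumption]. }
    destruct (mean_value_ge z dz l r s) as (c2 & H2 & _ & E2); auto.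
    { intros; apply Dz; [lra|assumption]. }
    destruct (mean_value_le z dz l s T) as (c3 & H3 & _ & E3); auto.
    { intros; apply Dz; [lra|assumption]. }
    (* The affine factor would be negative at [c1], nonnegative at [c2] and nonpositive at [c3],
       with [c1 < c2 < c3]. *)
    assert (dz c1 < 0) by nra. assert (0 <= dz c2) by nra. assert (dz c3 <= 0) by nra.
    unfold dz in *.
    pose proof (Hmu c1); pose proof (Hmu c2); pose proof (Hmu c3).
    assert (al + be * c1 < 0) by nra.
    assert (0 <= al + be * c2) by nra.
    assert (al + be * c3 <= 0) by nra.
    assert (0 < be) by nra. nra. }
  (* If [w t <= 0], then [z] is nonpositive somewhere before [t], hence negative from there on, and
     [w] cannot climb back to 0 at [T]. *)
  destruct (Rlt_dec 0 (w t)) as [|Hn]; [assumption|exfalso].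
  destruct (mean_value_le w z nil 0 t) as (s & Hs & _ & Es); auto; try lra.
  { intros; apply Dw; lra. }
  destruct (mean_value_ge w z nil t T) as (r & Hr & _ & Er); auto; try lra.
  { intros; apply Dw; lra. }
  assert (z s <= 0) by nra.
  assert (z r < 0) by (apply (P s r); lra).
  nra.
Qed.

Lemma is_derive_reverse (f : R -> R) (T s d : R) :
  is_derive f (T - s) d -> is_derive (fun s => f (T - s)) s (- d).
Proof.
  intros Hf. evar_last.
  - apply (is_derive_comp f (fun s => T - s) s d (-1)); [exact Hf|].
    auto_derive; auto; ring.
  - unfold scal; simpl; unfold mult; simpl; ring.
Qed.

(** Time reversal [t -> T - t] flips the sign of the velocity. This version serves the
    [e1]-coefficient of [x], which starts with velocity 0 and ends with velocity -1. *)
Lemma affine_control_pos_rev (T al be : R) (w z mu : R -> R) (l : list R) :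
  (forall t, continuous w t) -> (forall t, continuous z t) ->
  (forall t, 0 < t < T -> is_derive w t (z t)) ->
  (forall t, 0 < t < T -> ~ In t l -> is_derive z t (mu t * (al + be * t))) ->
  (forall t, 0 < mu t) ->
  w 0 = 0 -> w T = 0 -> z 0 = 0 -> z T < 0 ->
  forall t, 0 < t < T -> 0 < w t.
Proof.
  intros Cw Cz Dw Dz Hmu w0 wT z0 zT t Ht.
  assert (Cr : forall t, continuous (fun s => T - s) t).
  { intros s; apply (ex_derive_continuous (fun s => T - s)); auto_derive; auto. }
  replace t with (T - (T - t)) by ring.
  apply (affine_control_pos T (al + be * T) (- be) (fun s => w (T - s))
    (fun s => - z (T - s)) (fun s => mu (T - s)) (map (fun s => T - s) l));
    try (rewrite ?Rminus_0_r, ?Rminus_diag_eq; auto; lra).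
  - intros s; apply (continuous_comp (fun s => T - s) w); auto.
  - intros s; apply (continuous_opp (fun s => z (T - s))).
    apply (continuous_comp (fun s => T - s) z); auto.
  - intros s Hs. evar_last; [apply is_derive_reverse, Dw; lra|ring].
  - intros s Hs Hn.
    evar_last; [apply (is_derive_opp (fun s => z (T - s))), is_derive_reverse, Dz; [lra|]|].
    + intros Hi; apply Hn; replace s with (T - (T - s)) by ring.
      apply (in_map (fun s => T - s)), Hi.
    + unfold opp; simpl; ring.
  - lra.
Qed.

Lemma is_derive_cross (f g f' g' : R -> R) (t : R) (df dg df' dg' : R) :
  is_derive f t df -> is_derive g t dg -> is_derive f' t df' -> is_derive g' t dg' ->
  is_derive (fun s => f s * g' s - g s * f' s) t
    (df * g' t + f t * dg' - (dg * f' t + g t * df')).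
Proof.
  intros Hf Hg Hf' Hg'.
  apply (is_derive_minus (fun s => f s * g' s) (fun s => g s * f' s)).
  - evar_last; [apply (is_derive_mult f g' t df dg'); auto; intros; apply Rmult_comm|].
    unfold plus, mult; simpl; unfold mult; simpl; ring.
  - evar_last; [apply (is_derive_mult g f' t dg df'); auto; intros; apply Rmult_comm|].
    unfold plus, mult; simpl; unfold mult; simpl; ring.
Qed.

Lemma continuous_cross (f g f' g' : R -> R) (t : R) :
  continuous f t -> continuous g t -> continuous f' t -> continuous g' t ->
  continuous (fun s => f s * g' s - g s * f' s) t.
Proof.
  intros Hf Hg Hf' Hg'.
  apply (continuous_minus (fun s => f s * g' s) (fun s => g s * f' s));
    [apply (continuous_mult f g')|apply (continuous_mult g f')]; assumption.
Qed.

(* With [psi = a + b t], [F = x ^ psi] satisfies [F'' = 2 v ^ b] and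
   [(v ^ b)' = k m] has the sign of [k]; since [(x ^ v)' = m F], a negative
   value of [x ^ v] would force the sign pattern 0,-,+,0 on [F]. *)
Lemma angular_momentum_nonneg
  (T a1 a2 b1 b2 : R) (x1 x2 v1 v2 m : R -> R) (l : list R) :
  (forall t, continuous x1 t) -> (forall t, continuous x2 t) ->
  (forall t, continuous v1 t) -> (forall t, continuous v2 t) ->
  (forall t, 0 < t < T -> is_derive x1 t (v1 t)) ->
  (forall t, 0 < t < T -> is_derive x2 t (v2 t)) ->
  (forall t, 0 < t < T -> ~ In t l -> is_derive v1 t (m t * (a1 + b1 * t))) ->
  (forall t, 0 < t < T -> ~ In t l -> is_derive v2 t (m t * (a2 + b2 * t))) ->
  (forall t, 0 < m t) ->
  x1 0 = 0 -> x2 0 = 0 -> x1 T = 0 -> x2 T = 0 ->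
  0 < a1 * b2 - a2 * b1 ->
  forall t, 0 < t < T -> 0 <= x1 t * v2 t - x2 t * v1 t.
Proof.
  intros Cx1 Cx2 Cv1 Cv2 Dx1 Dx2 Dv1 Dv2 Hm x10 x20 x1T x2T Hk t Ht.
  set (p1 := fun s => a1 + b1 * s). set (p2 := fun s => a2 + b2 * s).
  set (L := fun s => x1 s * v2 s - x2 s * v1 s).
  set (F := fun s => x1 s * p2 s - x2 s * p1 s).
  set (F1 := fun s => (v1 s * p2 s - v2 s * p1 s) + (x1 s * b2 - x2 s * b1)).
  set (H := fun s => v1 s * b2 - v2 s * b1).
  assert (Dp1 : forall s, is_derive p1 s b1) by (intros; unfold p1; auto_derive; auto; ring).
  assert (Dp2 : forall s, is_derive p2 s b2) by (intros; unfold p2; auto_derive; auto; ring).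
  assert (Cp1 : forall s, continuous p1 s)
    by (intros; apply (ex_derive_continuous p1); eexists; apply Dp1).
  assert (Cp2 : forall s, continuous p2 s)
    by (intros; apply (ex_derive_continuous p2); eexists; apply Dp2).
  assert (CL : forall s, continuous L s) by (intros; apply continuous_cross; auto).
  assert (CF : forall s, continuous F s) by (intros; apply continuous_cross; auto).
  assert (CH : forall s, continuous H s).
  { intros; apply continuous_cross; auto; apply continuous_const. }
  assert (CF1 : forall s, continuous F1 s).
  { intros; unfold F1.
    apply (continuous_plus (fun s => v1 s * p2 s - v2 s * p1 s) (fun s => x1 s * b2 - x2 s * b1));
    apply continuous_cross; auto; apply continuous_const. }
  assert (DL : forall s, 0 < s < T -> ~ In s l -> is_derive L s (m s * F s)).
  { intros s Hs Hn. evar_last; [apply is_derive_cross; auto|].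
    unfold F, p1, p2; ring. }
  assert (DF : forall s, 0 < s < T -> is_derive F s (F1 s)).
  { intros s Hs. evar_last; [apply is_derive_cross; auto|]. unfold F1; ring. }
  (* The term v' ^ psi drops out because v' is a multiple of psi; the two copies of v ^ b remain. *)
  assert (DF1 : forall s, 0 < s < T -> ~ In s l -> is_derive F1 s (2 * H s)).
  { intros s Hs Hn.
    evar_last; [apply (is_derive_plus (fun s => v1 s * p2 s - v2 s * p1 s)
      (fun s => x1 s * b2 - x2 s * b1)); apply is_derive_cross; auto;
      apply (is_derive_const (K := R_AbsRing) (V := R_NormedModule))|].
    unfold plus, zero; simpl. unfold H, p1, p2; ring. }
  assert (DH : forall s, 0 < s < T -> ~ In s l ->
    is_derive H s (m s * (a1 * b2 - a2 * b1))).
  { intros s Hs Hn. evar_last; [apply is_derive_cross; auto;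
      apply (is_derive_const (K := R_AbsRing) (V := R_NormedModule))|].
    unfold zero; simpl; ring. }
  assert (L0 : L 0 = 0) by (unfold L; rewrite x10, x20; ring).
  assert (LT : L T = 0) by (unfold L; rewrite x1T, x2T; ring).
  assert (F0 : F 0 = 0) by (unfold F; rewrite x10, x20; ring).
  assert (FT : F T = 0) by (unfold F; rewrite x1T, x2T; ring).
  change (0 <= L t).
  destruct (Rle_dec 0 (L t)) as [|Hn]; [assumption|exfalso].
  destruct (mean_value_le L (fun s => m s * F s) l 0 t) as (c1 & H1 & _ & E1); auto; try lra.
  { intros; apply DL; [lra|assumption]. }
  destruct (mean_value_ge L (fun s => m s * F s) l t T) as (c2 & H2 & _ & E2); auto; try lra.
  { intros; apply DL; [lra|assumption]. }
  assert (F c1 < 0) by (pose proof (Hm c1); assert (m c1 * F c1 < 0) by nra; nra).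
  assert (0 < F c2) by (pose proof (Hm c2); assert (0 < m c2 * F c2) by nra; nra).
  destruct (mean_value_le F F1 nil 0 c1) as (d1 & I1 & _ & G1); auto; try lra.
  { intros; apply DF; lra. }
  destruct (mean_value_ge F F1 nil c1 c2) as (d2 & I2 & _ & G2); auto; try lra.
  { intros; apply DF; lra. }
  destruct (mean_value_le F F1 nil c2 T) as (d3 & I3 & _ & G3); auto; try lra.
  { intros; apply DF; lra. }
  (* Signs descend through the derivatives: 0,-,+,0 for [F] gives -,+,- for [F1], then +,- for [H],
     although [H] is increasing. *)
  assert (F1 d1 < 0) by nra. assert (0 < F1 d2) by nra. assert (F1 d3 < 0) by nra.
  destruct (mean_value_ge F1 (fun s => 2 * H s) l d1 d2) as (e1 & J1 & _ & K1); auto; try lra.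
  { intros; apply DF1; [lra|assumption]. }
  destruct (mean_value_le F1 (fun s => 2 * H s) l d2 d3) as (e2 & J2 & _ & K2); auto; try lra.
  { intros; apply DF1; [lra|assumption]. }
  assert (0 < H e1) by nra. assert (H e2 < 0) by nra.
  destruct (mean_value_le H (fun s => m s * (a1 * b2 - a2 * b1)) l e1 e2)
    as (q & Q & _ & K); auto; try lra.
  { intros; apply DH; [lra|assumption]. }
  assert (0 < m q * (a1 * b2 - a2 * b1)) by (apply Rmult_lt_0_compat; auto).
  nra.
Qed.

(** * Processes assembled from continuous controls *)

Lemma continuous_pair (f g : R -> R) (t : R) :
  continuous f t -> continuous g t -> continuous (fun s => (f s, g s) : plane) t.
Proof.
  intros Hf Hg. apply (continuous_comp_2 f g (fun a b => (a, b) : plane)); auto.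
  intros P [e He]; exists e; intros [y1 y2] H; apply He, H.
Qed.

Lemma is_derive_pair (f g : R -> R) (t df dg : R) :
  is_derive f t df -> is_derive g t dg ->
  is_derive (fun s => (f s, g s) : plane) t (df, dg).
Proof.
  intros Hf Hg.
  set (W := prod_NormedModule R_AbsRing R_NormedModule R_NormedModule).
  pose proof (is_derive_scal_l f t df ((1, 0) : W) Hf) as Hf'.
  pose proof (is_derive_scal_l g t dg ((0, 1) : W) Hg) as Hg'.
  pose proof (is_derive_plus _ _ _ _ _ Hf' Hg') as H.
  evar_last; [eapply is_derive_ext; [|exact H]|]; [intros s|];
    unfold plus, scal; simpl; unfold prod_plus, prod_scal; simpl;
    unfold plus, scal; simpl; unfold mult; simpl; f_equal; ring.
Qed.

Lemma norm_plane (a b : R) : norm ((a, b) : plane) = sqrt (a ^ 2 + b ^ 2).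
Proof.
  unfold norm; simpl; unfold prod_norm; simpl; unfold norm; simpl; unfold abs; simpl.
  f_equal; rewrite !Rmult_1_r, <- !Rabs_mult, !Rabs_pos_eq; nra.
Qed.

Lemma is_derive_RInt_continuous (f : R -> R) (t : R) :
  (forall s, continuous f s) -> is_derive (fun s => RInt f 0 s) t (f t).
Proof.
  intros Hf. apply (is_derive_RInt f (fun s => RInt f 0 s) 0 t); auto.
  apply filter_forall; intros s; apply (RInt_correct f).
  apply (ex_RInt_continuous f); auto.
Qed.

(** Integration by parts gives x(t) = t v(t) - int_0^t s u(s) ds, which avoids a double integral.
    Given v(T) = v_f, the condition x(T) = 0 becomes int s u(s) ds = T v_f = (-T, 0). *)
Lemma return_process_of_moments (T p q : R) (u1 u2 : R -> R) :
  0 <= T ->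
  (forall t, continuous u1 t) -> (forall t, continuous u2 t) ->
  (forall t, u1 t ^ 2 + u2 t ^ 2 <= 1) ->
  RInt u1 0 T = - 1 - p -> RInt u2 0 T = - q ->
  RInt (fun t => t * u1 t) 0 T = - T -> RInt (fun t => t * u2 t) 0 T = 0 ->
  exists u x v, return_process (p, q) T u x v.
Proof.
  intros HT C1 C2 Hu M1 M2 M3 M4.
  assert (Cid : forall (f : R -> R) t, continuous f t -> continuous (fun t => t * f t) t).
  { intros f t Hf; apply (continuous_mult (fun t => t) f); auto; apply continuous_id. }
  set (V := fun (p : R) (f : R -> R) t => p + RInt f 0 t).
  set (X := fun (p : R) (f : R -> R) t => t * V p f t - RInt (fun t => t * f t) 0 t).
  assert (DV : forall p f t, (forall s, continuous f s) -> is_derive (V p f) t (f t)).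
  { intros p' f t Hf; unfold V.
    evar_last; [apply (is_derive_plus (fun _ => p') (fun t => RInt f 0 t));
      [apply (is_derive_const (K := R_AbsRing) (V := R_NormedModule)) | apply is_derive_RInt_continuous, Hf]|].
    unfold plus, zero; simpl; ring. }
  assert (DX : forall p f t, (forall s, continuous f s) -> is_derive (X p f) t (V p f t)).
  { intros p' f t Hf; unfold X.
    evar_last; [apply (is_derive_minus (fun t => t * V p' f t) (fun t => RInt (fun t => t * f t) 0 t));
      [apply (is_derive_mult (fun t => t) (V p' f) t 1 (f t)); auto;
        [auto_derive; auto; ring | intros; apply Rmult_comm]
      | apply is_derive_RInt_continuous; intros; apply Cid, Hf]|].
    unfold minus, opp, plus, mult; simpl; unfold mult; simpl; ring. }
  assert (Cu : forall t, continuous (fun s => (u1 s, u2 s) : plane) t)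
    by (intros; apply continuous_pair; auto).
  assert (Cseg : forall (f : R -> plane) a b, (forall t, continuous f t) -> continuous_on_segment f a b).
  { intros f a b Hf t _. eapply filterlim_filter_le_1; [apply filter_le_within|apply Hf]. }
  assert (CV : forall t, continuous (fun s => (V p u1 s, V q u2 s) : plane) t).
  { intros t; apply continuous_pair; apply (ex_derive_continuous (V _ _)); eexists; apply DV; auto. }
  assert (CX : forall t, continuous (fun s => (X p u1 s, X q u2 s) : plane) t).
  { intros t; apply continuous_pair; apply (ex_derive_continuous (X _ _)); eexists; apply DX; auto. }
  exists (fun t => (u1 t, u2 t)), (fun t => (X p u1 t, X q u2 t)), (fun t => (V p u1 t, V q u2 t)).
  split; auto.
  - split; [split; [|split]|].
    + exists nil; intros; apply Cu.
    + intros t _; exists (u1 t, u2 t).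
      eapply filterlim_filter_le_1; [apply filter_le_within|apply Cu].
    + intros t _; exists (u1 t, u2 t).
      eapply filterlim_filter_le_1; [apply filter_le_within|apply Cu].
    + intros t _. rewrite norm_plane, <- sqrt_1. apply sqrt_le_1_alt, Hu.
  - intros t _; apply is_derive_pair; apply DX; auto.
  - intros t _ _; apply is_derive_pair; apply DV; auto.
  - unfold X, V. rewrite !RInt_point. unfold zero; simpl. f_equal; ring.
  - unfold V. rewrite !RInt_point. unfold zero; simpl. f_equal; ring.
  - unfold X, V. rewrite M1, M2, M3, M4. f_equal; ring.
  - unfold V. rewrite M1, M2. unfold v_f. f_equal; ring.
Qed.

(** * Minimising Lipschitz functions over a box in R^4 *)

(** Adds one real coordinate to a minimisation: the partial minimum over [Y] inherits the Lipschitz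
    bound in [s], which is uniform in [y], so the extreme value theorem on the segment applies to
    it. *)
Lemma exists_min_product {Y : Type} (P : Y -> Prop) (f : R -> Y -> R) (a b M : R) :
  a <= b ->
  (forall s s' y, Rabs (f s y - f s' y) <= M * Rabs (s - s')) ->
  (forall s, exists y, P y /\ forall y', P y' -> f s y <= f s y') ->
  exists s y, a <= s <= b /\ P y /\
    forall s' y', a <= s' <= b -> P y' -> f s y <= f s' y'.
Proof.
  intros Hab Hlip Hmin.
  set (g := fun s => proj1_sig (constructive_indefinite_description _ (Hmin s))).
  assert (Hg : forall s, P (g s) /\ forall y', P y' -> f s (g s) <= f s y').
  { intros s; unfold g; destruct (constructive_indefinite_description _ (Hmin s)); auto. }
  assert (Hle : forall s s', f s (g s) <= f s' (g s') + M * Rabs (s - s')).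
  { intros s s'. destruct (Hg s) as [_ H]. specialize (H _ (proj1 (Hg s'))).
    pose proof (Rle_trans _ _ _ (Rle_abs _) (Hlip s s' (g s'))). lra. }
  destruct (continuity_ab_min (fun s => f s (g s)) a b Hab) as (s & Hs & Hsab).
  - intros c _ eps Heps.
    (* [M] may be zero or negative; [Rabs M + 1] is a positive Lipschitz constant in every case. *)
    exists (eps / (Rabs M + 1)). split.
    { apply Rdiv_lt_0_compat; [assumption|]. pose proof (Rabs_pos M); lra. }
    intros s [_ Hs]. simpl in Hs |- *. unfold Rdist in *.
    apply Rle_lt_trans with (Rabs M * Rabs (s - c)).
    + pose proof (Hle s c). pose proof (Hle c s). rewrite (Rabs_minus_sym c s) in H0.
      assert (M * Rabs (s - c) <= Rabs M * Rabs (s - c))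
        by (apply Rmult_le_compat_r; [apply Rabs_pos|apply Rle_abs]).
      apply Rabs_le; lra.
    + pose proof (Rabs_pos M). pose proof (Rabs_pos (s - c)).
      apply Rmult_lt_compat_l with (r := Rabs M + 1) in Hs; [|lra].
      replace ((Rabs M + 1) * (eps / (Rabs M + 1))) with eps in Hs by (field; lra). lra.
  - exists s, (g s). split; [assumption|split; [apply Hg|]].
    intros s' y' Hs' Hy'. apply Rle_trans with (f s' (g s')); [apply Hs, Hs'|apply Hg, Hy'].
Qed.

(** The sup norm is chosen because its balls are products of intervals, which can be minimised over
    one coordinate at a time. *)
Definition max_norm (a1 a2 b1 b2 : R) : R :=
  Rmax (Rmax (Rabs a1) (Rabs a2)) (Rmax (Rabs b1) (Rabs b2)).

Lemma max_norm_le (a1 a2 b1 b2 r : R) :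
  max_norm a1 a2 b1 b2 <= r <->
  Rabs a1 <= r /\ Rabs a2 <= r /\ Rabs b1 <= r /\ Rabs b2 <= r.
Proof.
  unfold max_norm; split.
  - intros H.
    pose proof (Rmax_l (Rmax (Rabs a1) (Rabs a2)) (Rmax (Rabs b1) (Rabs b2))).
    pose proof (Rmax_r (Rmax (Rabs a1) (Rabs a2)) (Rmax (Rabs b1) (Rabs b2))).
    pose proof (Rmax_l (Rabs a1) (Rabs a2)). pose proof (Rmax_r (Rabs a1) (Rabs a2)).
    pose proof (Rmax_l (Rabs b1) (Rabs b2)). pose proof (Rmax_r (Rabs b1) (Rabs b2)).
    lra.
  - intros (H1 & H2 & H3 & H4); repeat apply Rmax_lub; assumption.
Qed.

Definition l1_norm (a1 a2 b1 b2 : R) : R := Rabs a1 + Rabs a2 + Rabs b1 + Rabs b2.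

(** The one-sided bound yields the absolute value by exchanging the two points, and the l1 norm
    reduces to a single absolute value when one coordinate moves. *)
Definition l1_lipschitz (M : R) (f : R -> R -> R -> R -> R) : Prop :=
  forall a1 a2 b1 b2 a1' a2' b1' b2',
    f a1 a2 b1 b2 - f a1' a2' b1' b2' <=
    M * l1_norm (a1 - a1') (a2 - a2') (b1 - b1') (b2 - b2').

Lemma exists_min_box (f : R -> R -> R -> R -> R) (M r : R) :
  0 <= r -> l1_lipschitz M f ->
  exists a1 a2 b1 b2, max_norm a1 a2 b1 b2 <= r /\
    forall a1' a2' b1' b2', max_norm a1' a2' b1' b2' <= r ->
      f a1 a2 b1 b2 <= f a1' a2' b1' b2'.
Proof.
  intros Hr Hlip.
  assert (Hab : - r <= r) by lra.
  pose (I := fun s => - r <= s <= r).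
  assert (Habs : forall x y k, x - y <= k -> y - x <= k -> Rabs (x - y) <= k)
    by (intros; apply Rabs_le; lra).
  assert (Z : forall x : R, Rabs (x - x) = 0)
    by (intros; unfold Rminus; rewrite Rplus_opp_r; apply Rabs_R0).
  assert (H4 : forall s : R * (R * R), exists b2, I b2 /\ forall b2', I b2' ->
    f (fst s) (fst (snd s)) (snd (snd s)) b2 <= f (fst s) (fst (snd s)) (snd (snd s)) b2').
  { intros s.
    (* A trivial second factor starts the iteration, which then adds [b1], [a2] and [a1]. *)
    destruct (exists_min_product (fun _ : unit => True)
      (fun b2 _ => f (fst s) (fst (snd s)) (snd (snd s)) b2) (-r) r M Hab) as (b2 & y & H & _ & K).
    - intros b b' _. apply Habs; (eapply Rle_trans; [apply Hlip|]);
        unfold l1_norm; rewrite !Z, ?(Rabs_minus_sym b b'); right; ring.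
    - intros b; exists tt; split; auto. intros; right; reflexivity.
    - exists b2; split; auto. }
  assert (H3 : forall s : R * R, exists b, (I (fst b) /\ I (snd b)) /\ forall b', (I (fst b') /\ I (snd b')) ->
    f (fst s) (snd s) (fst b) (snd b) <= f (fst s) (snd s) (fst b') (snd b')).
  { intros s.
    destruct (exists_min_product I (fun b1 b2 => f (fst s) (snd s) b1 b2) (-r) r M Hab)
      as (b1 & b2 & H & H' & K).
    - intros b b' c. apply Habs; (eapply Rle_trans; [apply Hlip|]);
        unfold l1_norm; rewrite !Z, ?(Rabs_minus_sym b b'); right; ring.
    - intros b1; apply (H4 (fst s, (snd s, b1))).
    - exists (b1, b2); split; [split; assumption|]. intros b' [? ?]; apply K; auto. }
  assert (H2 : forall a1, exists b, (I (fst b) /\ I (fst (snd b)) /\ I (snd (snd b))) /\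
    forall b', (I (fst b') /\ I (fst (snd b')) /\ I (snd (snd b'))) ->
    f a1 (fst b) (fst (snd b)) (snd (snd b)) <= f a1 (fst b') (fst (snd b')) (snd (snd b'))).
  { intros a1.
    destruct (exists_min_product (fun b => I (fst b) /\ I (snd b))
      (fun a2 b => f a1 a2 (fst b) (snd b)) (-r) r M Hab) as (a2 & b & H & H' & K).
    - intros a a' c. apply Habs; (eapply Rle_trans; [apply Hlip|]);
        unfold l1_norm; rewrite !Z, ?(Rabs_minus_sym a a'); right; ring.
    - intros a2; apply (H3 (a1, a2)).
    - exists (a2, b); split; [split; assumption|]. intros b' [? ?]; apply K; auto. }
  destruct (exists_min_product (fun b => I (fst b) /\ I (fst (snd b)) /\ I (snd (snd b)))
      (fun a1 b => f a1 (fst b) (fst (snd b)) (snd (snd b))) (-r) r M Hab) as (a1 & b & H & H' & K).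
  - intros a a' c. apply Habs; (eapply Rle_trans; [apply Hlip|]);
        unfold l1_norm; rewrite !Z, ?(Rabs_minus_sym a a'); right; ring.
  - exact H2.
  - exists a1, (fst b), (fst (snd b)), (snd (snd b)). split.
    + apply max_norm_le. unfold I in H'. repeat split; apply Rabs_le; tauto.
    + intros a1' a2' b1' b2' Hm. apply max_norm_le in Hm.
      destruct Hm as (A1 & A2 & B1 & B2).
      apply Rabs_le_between in A1, A2, B1, B2.
      apply (K a1' (a2', (b1', b2'))); [lra|]. unfold I; simpl; lra.
Qed.

(** * The dual cost and its Lipschitz bound *)

(** [k = 0] is |psi t|, and [k = 1] is its smoothing. *)
Definition costate_norm (k a1 a2 b1 b2 t : R) : R :=
  sqrt (k + (a1 + b1 * t) ^ 2 + (a2 + b2 * t) ^ 2).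

(** The linear terms are -a . (v_f - v0) - T b . v_f with v0 = (p, q) and v_f = (-1, 0) substituted,
    whence the absence of [b2] from them. *)
Definition dual_cost (k T p q a1 a2 b1 b2 : R) : R :=
  RInt (costate_norm k a1 a2 b1 b2) 0 T + a1 * (1 + p) + a2 * q + T * b1.

Lemma continuous_costate_norm (k a1 a2 b1 b2 t : R) :
  continuous (costate_norm k a1 a2 b1 b2) t.
Proof.
  apply (continuous_sqrt_comp (fun t => k + (a1 + b1 * t) ^ 2 + (a2 + b2 * t) ^ 2)).
  apply (ex_derive_continuous (fun t => k + (a1 + b1 * t) ^ 2 + (a2 + b2 * t) ^ 2)).
  auto_derive; auto.
Qed.

Lemma ex_RInt_costate_norm (k a1 a2 b1 b2 s t : R) :
  ex_RInt (costate_norm k a1 a2 b1 b2) s t.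
Proof. apply (ex_RInt_continuous (costate_norm k a1 a2 b1 b2)); intros; apply continuous_costate_norm. Qed.

(** One variable moves at a time while the other square is absorbed into [k]; sqrt (k + y^2) is
    1-Lipschitz in [y] because it dominates |y|. *)
Lemma sqrt_sum_sqr_lipschitz (k y z y' z' : R) : 0 <= k ->
  sqrt (k + y ^ 2 + z ^ 2) <= sqrt (k + y' ^ 2 + z' ^ 2) + Rabs (y - y') + Rabs (z - z').
Proof.
  intros Hk.
  assert (one : forall k y y', 0 <= k -> sqrt (k + y ^ 2) <= sqrt (k + y' ^ 2) + Rabs (y - y')).
  { clear; intros k y y' Hk. set (S := sqrt (k + y' ^ 2)).
    assert (HS : S * S = k + y' ^ 2) by (apply sqrt_sqrt; nra).
    assert (0 <= S) by apply sqrt_pos.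
    assert (Rabs y' <= S).
    { rewrite <- sqrt_Rsqr_abs; apply sqrt_le_1_alt; unfold Rsqr; nra. }
    pose proof (Rabs_pos (y - y')).
    rewrite <- (sqrt_pow2 (S + Rabs (y - y'))) by lra.
    apply sqrt_le_1_alt.
    assert (Rabs (y - y') * Rabs (y - y') = (y - y') * (y - y'))
      by (rewrite <- Rabs_mult; apply Rabs_pos_eq, Rle_0_sqr).
    assert (y' * (y - y') <= S * Rabs (y - y')).
    { eapply Rle_trans; [apply Rle_abs|]. rewrite Rabs_mult. apply Rmult_le_compat_r; auto. }
    nra. }
  pose proof (one (k + y ^ 2) z z' ltac:(nra)).
  pose proof (one (k + z' ^ 2) y y' ltac:(nra)).
  replace (k + z' ^ 2 + y ^ 2) with (k + y ^ 2 + z' ^ 2) in H0 by ring.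
  replace (k + z' ^ 2 + y' ^ 2) with (k + y' ^ 2 + z' ^ 2) in H0 by ring.
  lra.
Qed.

Lemma costate_norm_lipschitz (k T : R) : 0 <= k -> forall t, 0 <= t <= T ->
  l1_lipschitz (1 + T) (fun a1 a2 b1 b2 => costate_norm k a1 a2 b1 b2 t).
Proof.
  intros Hk t Ht a1 a2 b1 b2 a1' a2' b1' b2'.
  unfold costate_norm, l1_norm.
  pose proof (sqrt_sum_sqr_lipschitz k (a1 + b1 * t) (a2 + b2 * t) (a1' + b1' * t) (a2' + b2' * t) Hk).
  assert (E : forall a b a' b', Rabs (a + b * t - (a' + b' * t)) <= Rabs (a - a') + T * Rabs (b - b')).
  { intros. replace (a + b * t - (a' + b' * t)) with ((a - a') + t * (b - b')) by ring.
    eapply Rle_trans; [apply Rabs_triang|]. apply Rplus_le_compat_l.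
    rewrite Rabs_mult, (Rabs_pos_eq t) by lra.
    apply Rmult_le_compat_r; [apply Rabs_pos|lra]. }
  pose proof (E a1 b1 a1' b1'). pose proof (E a2 b2 a2' b2').
  pose proof (Rabs_pos (a1 - a1')). pose proof (Rabs_pos (a2 - a2')).
  pose proof (Rabs_pos (b1 - b1')). pose proof (Rabs_pos (b2 - b2')).
  nra.
Qed.

Lemma dual_cost_lipschitz (k T p q : R) : 0 <= k -> 0 <= T ->
  l1_lipschitz (T * (1 + T) + Rabs (1 + p) + Rabs q + T) (dual_cost k T p q).
Proof.
  intros Hk HT a1 a2 b1 b2 a1' a2' b1' b2'. unfold dual_cost.
  set (N := l1_norm (a1 - a1') (a2 - a2') (b1 - b1') (b2 - b2')).
  assert (HI : RInt (costate_norm k a1 a2 b1 b2) 0 T <=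
    RInt (fun t => costate_norm k a1' a2' b1' b2' t + (1 + T) * N) 0 T).
  { apply RInt_le; auto.
    - apply ex_RInt_costate_norm.
    - apply (ex_RInt_plus (costate_norm k a1' a2' b1' b2') (fun _ => (1 + T) * N)).
      apply ex_RInt_costate_norm. apply ex_RInt_const.
    - intros t Ht. pose proof (costate_norm_lipschitz k T Hk t ltac:(lra)
        a1 a2 b1 b2 a1' a2' b1' b2'). simpl in H. fold N in H. lra. }
  assert (HI' : RInt (fun t => costate_norm k a1' a2' b1' b2' t + (1 + T) * N) 0 T =
    RInt (costate_norm k a1' a2' b1' b2') 0 T + T * ((1 + T) * N)).
  { evar_last. apply (RInt_plus (costate_norm k a1' a2' b1' b2') (fun _ => (1 + T) * N)).
    apply ex_RInt_costate_norm. apply ex_RInt_const.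
    rewrite RInt_const. unfold plus, scal; simpl; unfold mult; simpl. ring. }
  assert (E : forall x y c, x * c - y * c <= Rabs c * Rabs (x - y)).
  { intros. rewrite <- Rabs_mult. eapply Rle_trans; [|apply Rle_abs]. right; ring. }
  pose proof (E a1 a1' (1 + p)). pose proof (E a2 a2' q). pose proof (E b1 b1' T).
  rewrite (Rabs_pos_eq T) in H1 by assumption.
  pose proof (Rabs_pos (a1 - a1')). pose proof (Rabs_pos (a2 - a2')).
  pose proof (Rabs_pos (b1 - b1')). pose proof (Rabs_pos (b2 - b2')).
  assert (Rabs (1 + p) * Rabs (a1 - a1') <= Rabs (1 + p) * N)
    by (apply Rmult_le_compat_l; [apply Rabs_pos|unfold N, l1_norm; lra]).
  assert (Rabs q * Rabs (a2 - a2') <= Rabs q * N)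
    by (apply Rmult_le_compat_l; [apply Rabs_pos|unfold N, l1_norm; lra]).
  assert (T * Rabs (b1 - b1') <= T * N)
    by (apply Rmult_le_compat_l; [assumption|unfold N, l1_norm; lra]).
  lra.
Qed.

(** * First variation and reachability *)

Lemma nonneg_quadratic_slope_zero (G C e : R) : 0 < e ->
  (forall h, Rabs h <= e -> 0 <= h * G + h ^ 2 * C) -> G = 0.
Proof.
  intros He H. destruct (Req_dec G 0) as [|HG]; [assumption|exfalso].
  assert (HG' : 0 < Rabs G) by (apply Rabs_pos_lt; assumption).
  assert (HC : 0 <= Rabs C) by apply Rabs_pos.
  (* The test value is [h = - tau * G]: the first bound keeps |h| within [e], the second makes the
     linear term beat the quadratic one. *)
  set (tau := Rmin (e / Rabs G) (/ (2 * (Rabs C + 1)))).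
  assert (Ht : 0 < tau).
  { apply Rmin_glb_lt; [apply Rdiv_lt_0_compat|apply Rinv_0_lt_compat]; lra. }
  assert (H1 : tau * Rabs G <= e).
  { apply Rle_trans with (e / Rabs G * Rabs G).
    - apply Rmult_le_compat_r; [lra|apply Rmin_l].
    - right; field; lra. }
  assert (H2 : tau * (2 * (Rabs C + 1)) <= 1).
  { apply Rle_trans with (/ (2 * (Rabs C + 1)) * (2 * (Rabs C + 1))).
    - apply Rmult_le_compat_r; [lra|apply Rmin_r].
    - right; field; lra. }
  specialize (H (- (tau * G))).
  rewrite Rabs_Ropp, Rabs_mult, (Rabs_pos_eq tau) in H by lra. specialize (H H1).
  replace (- (tau * G) * G + (- (tau * G)) ^ 2 * C) with (tau * G ^ 2 * (tau * C - 1)) in H by ring.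
  assert (tau * C <= tau * Rabs C) by (apply Rmult_le_compat_l; [lra|apply Rle_abs]).
  assert (0 < G ^ 2) by nra.
  assert (0 < tau * G ^ 2) by nra.
  nra.
Qed.

Lemma costate_norm_ge_1 (a1 a2 b1 b2 t : R) : 1 <= costate_norm 1 a1 a2 b1 b2 t.
Proof.
  unfold costate_norm. rewrite <- sqrt_1 at 1. apply sqrt_le_1_alt.
  pose proof (pow2_ge_0 (a1 + b1 * t)). pose proof (pow2_ge_0 (a2 + b2 * t)). lra.
Qed.

(* AM-GM: [sqrt B <= (B + S^2) / (2 S)] with [S] the unperturbed norm. *)
Lemma costate_norm_perturb (a1 a2 b1 b2 c1 c2 d1 d2 h t : R) :
  costate_norm 1 (a1 + h * c1) (a2 + h * c2) (b1 + h * d1) (b2 + h * d2) t <=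
  costate_norm 1 a1 a2 b1 b2 t +
  h * (((a1 + b1 * t) * (c1 + d1 * t) + (a2 + b2 * t) * (c2 + d2 * t)) /
       costate_norm 1 a1 a2 b1 b2 t) +
  h ^ 2 * ((c1 + d1 * t) ^ 2 + (c2 + d2 * t) ^ 2).
Proof.
  pose proof (costate_norm_ge_1 a1 a2 b1 b2 t) as HS.
  pose proof (costate_norm_ge_1 (a1 + h * c1) (a2 + h * c2) (b1 + h * d1) (b2 + h * d2) t) as HB.
  set (S := costate_norm 1 a1 a2 b1 b2 t) in *.
  set (B := costate_norm 1 (a1 + h * c1) (a2 + h * c2) (b1 + h * d1) (b2 + h * d2) t) in *.
  assert (SS : S * S = 1 + (a1 + b1 * t) ^ 2 + (a2 + b2 * t) ^ 2).
  { apply sqrt_sqrt. pose proof (pow2_ge_0 (a1 + b1 * t)). pose proof (pow2_ge_0 (a2 + b2 * t)). lra. }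
  assert (BB : B * B = 1 + (a1 + h * c1 + (b1 + h * d1) * t) ^ 2 + (a2 + h * c2 + (b2 + h * d2) * t) ^ 2).
  { apply sqrt_sqrt. pose proof (pow2_ge_0 (a1 + h * c1 + (b1 + h * d1) * t)).
    pose proof (pow2_ge_0 (a2 + h * c2 + (b2 + h * d2) * t)). lra. }
  set (x := (a1 + b1 * t) * (c1 + d1 * t) + (a2 + b2 * t) * (c2 + d2 * t)).
  set (w := (c1 + d1 * t) ^ 2 + (c2 + d2 * t) ^ 2).
  assert (Hw : 0 <= w) by (unfold w; pose proof (pow2_ge_0 (c1 + d1 * t)); pose proof (pow2_ge_0 (c2 + d2 * t)); lra).
  assert (E : B * B = S * S + 2 * h * x + h ^ 2 * w) by (rewrite BB, SS; unfold x, w; ring).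
  apply Rmult_le_reg_r with (2 * S); [lra|].
  replace ((S + h * (x / S) + h ^ 2 * w) * (2 * S))
    with (2 * (S * S) + 2 * h * x + 2 * (h ^ 2 * w) * S) by (field; lra).
  pose proof (pow2_ge_0 h). assert (0 <= h ^ 2 * w) by nra.
  (* The smoothing pays off here: [S >= 1] bounds the quadratic remainder by [h ^ 2 * w], with no
     small denominator. *)
  assert (h ^ 2 * w <= h ^ 2 * w * S) by nra.
  pose proof (pow2_ge_0 (B - S)). nra.
Qed.

(** Integrating the upper bound of [costate_norm_perturb] and comparing with the minimum gives 0 <=
    h G + h^2 C for all small [h] of either sign, where G is the left-hand side of the claim. This
    replaces differentiation under the integral. *)
Lemma dual_cost_first_variation (T p q r a1 a2 b1 b2 : R) :
  0 <= T -> max_norm a1 a2 b1 b2 < r ->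
  (forall a1' a2' b1' b2', max_norm a1' a2' b1' b2' <= r ->
    dual_cost 1 T p q a1 a2 b1 b2 <= dual_cost 1 T p q a1' a2' b1' b2') ->
  forall c1 c2 d1 d2,
  RInt (fun t => ((a1 + b1 * t) * (c1 + d1 * t) + (a2 + b2 * t) * (c2 + d2 * t)) /
    costate_norm 1 a1 a2 b1 b2 t) 0 T + c1 * (1 + p) + c2 * q + T * d1 = 0.
Proof.
  intros HT Hin Hmin c1 c2 d1 d2.
  set (S := costate_norm 1 a1 a2 b1 b2).
  set (g := fun t => ((a1 + b1 * t) * (c1 + d1 * t) + (a2 + b2 * t) * (c2 + d2 * t)) / S t).
  set (w := fun t => (c1 + d1 * t) ^ 2 + (c2 + d2 * t) ^ 2).
  assert (Ig : ex_RInt g 0 T).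
  { apply (ex_RInt_continuous g); intros t _. unfold g, Rdiv.
    apply (continuous_mult (fun t => (a1 + b1 * t) * (c1 + d1 * t) + (a2 + b2 * t) * (c2 + d2 * t)) (fun t => / S t)).
    - apply (ex_derive_continuous (fun t => (a1 + b1 * t) * (c1 + d1 * t) + (a2 + b2 * t) * (c2 + d2 * t))).
      auto_derive; auto.
    - apply (continuous_comp S Rinv); [apply continuous_costate_norm|].
      apply continuous_Rinv. pose proof (costate_norm_ge_1 a1 a2 b1 b2 t). unfold S; lra. }
  assert (Iw : ex_RInt w 0 T).
  { apply (ex_RInt_continuous w); intros t _.
    apply (ex_derive_continuous w); unfold w; auto_derive; auto. }
  set (N := max_norm c1 c2 d1 d2). set (rho := max_norm a1 a2 b1 b2) in *.
  destruct (proj1 (max_norm_le c1 c2 d1 d2 N) (Rle_refl _)) as (N1 & N2 & N3 & N4).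
  destruct (proj1 (max_norm_le a1 a2 b1 b2 rho) (Rle_refl _)) as (R1 & R2 & R3 & R4).
  assert (HN : 0 <= N) by (pose proof (Rabs_pos c1); lra).
  (* This range of [h] keeps the perturbed point in the box; [N + 1] covers the zero direction. *)
  apply (nonneg_quadratic_slope_zero _ (RInt w 0 T) ((r - rho) / (N + 1))).
  { apply Rdiv_lt_0_compat; lra. }
  intros h Hh.
  assert (HhN : Rabs h * (N + 1) <= r - rho).
  { apply Rle_trans with ((r - rho) / (N + 1) * (N + 1)).
    - apply Rmult_le_compat_r; lra.
    - right; field; lra. }
  assert (K : forall a c, Rabs a <= rho -> Rabs c <= N -> Rabs (a + h * c) <= r).
  { intros a c Ha Hc. eapply Rle_trans; [apply Rabs_triang|]. rewrite Rabs_mult.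
    pose proof (Rabs_pos h). nra. }
  assert (Hbox : max_norm (a1 + h * c1) (a2 + h * c2) (b1 + h * d1) (b2 + h * d2) <= r)
    by (apply max_norm_le; auto).
  specialize (Hmin _ _ _ _ Hbox). unfold dual_cost in Hmin. fold S in Hmin.
  assert (IB : is_RInt (fun t => plus (plus (S t) (scal h (g t))) (scal (h ^ 2) (w t))) 0 T
    (plus (plus (RInt S 0 T) (scal h (RInt g 0 T))) (scal (h ^ 2) (RInt w 0 T)))).
  { apply (is_RInt_plus (fun t => plus (S t) (scal h (g t))) (fun t => scal (h ^ 2) (w t))).
    - apply (is_RInt_plus S (fun t => scal h (g t))).
      + apply (RInt_correct S), ex_RInt_costate_norm.
      + apply (is_RInt_scal g), (RInt_correct g), Ig.
    - apply (is_RInt_scal w), (RInt_correct w), Iw. }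
  pose proof (is_RInt_le _ _ 0 T _ _ HT
    (RInt_correct _ _ _ (ex_RInt_costate_norm 1 (a1 + h * c1) (a2 + h * c2) (b1 + h * d1) (b2 + h * d2) 0 T)) IB
    (fun t _ => costate_norm_perturb a1 a2 b1 b2 c1 c2 d1 d2 h t)) as HI.
  unfold plus, scal in HI; simpl in HI; unfold mult in HI; simpl in HI.
  simpl in Hmin |- *. lra.
Qed.

Lemma dual_cost_0 (k T p q : R) : dual_cost k T p q 0 0 0 0 = T * sqrt k.
Proof.
  unfold dual_cost. rewrite (RInt_ext _ (fun _ => sqrt k)).
  - rewrite RInt_const. unfold scal; simpl; unfold mult; simpl. ring.
  - intros t _. unfold costate_norm. f_equal; ring.
Qed.

(* An interior minimiser of the smoothed dual cost solves the moment problem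
   with the control [psi / sqrt (1 + |psi|^2)]. *)
Lemma reachable_or_dual_boundary (T p q r : R) : 0 <= T -> 0 < r ->
  (exists u x v, return_process (p, q) T u x v) \/
  (exists a1 a2 b1 b2, max_norm a1 a2 b1 b2 = r /\ dual_cost 1 T p q a1 a2 b1 b2 <= T).
Proof.
  intros HT Hr.
  destruct (exists_min_box _ _ r (Rlt_le _ _ Hr) (dual_cost_lipschitz 1 T p q Rle_0_1 HT))
    as (a1 & a2 & b1 & b2 & Hm & Hmin).
  destruct Hm as [Hm|Hm].
  - left.
    pose proof (dual_cost_first_variation T p q r a1 a2 b1 b2 HT Hm Hmin) as FV.
    set (S := costate_norm 1 a1 a2 b1 b2) in *.
    assert (HS : forall t, 1 <= S t) by (intros; apply costate_norm_ge_1).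
    assert (Cu : forall a b t, continuous (fun t => (a + b * t) / S t) t).
    { intros a b t. unfold Rdiv. apply (continuous_mult (fun t => a + b * t) (fun t => / S t)).
      - apply (ex_derive_continuous (fun t => a + b * t)); auto_derive; auto.
      - apply (continuous_comp S Rinv); [apply continuous_costate_norm|].
        apply continuous_Rinv. specialize (HS t); lra. }
    apply (return_process_of_moments T p q (fun t => (a1 + b1 * t) / S t) (fun t => (a2 + b2 * t) / S t)); auto.
    + intros t. specialize (HS t).
      assert (SS : S t * S t = 1 + (a1 + b1 * t) ^ 2 + (a2 + b2 * t) ^ 2).
      { apply sqrt_sqrt. pose proof (pow2_ge_0 (a1 + b1 * t)). pose proof (pow2_ge_0 (a2 + b2 * t)). lra. }
      apply Rmult_le_reg_r with (S t * S t); [nra|].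
      replace ((((a1 + b1 * t) / S t) ^ 2 + ((a2 + b2 * t) / S t) ^ 2) * (S t * S t))
        with ((a1 + b1 * t) ^ 2 + (a2 + b2 * t) ^ 2) by (field; lra).
      lra.
    (* The four coordinate directions yield the four moment equations. In each, both integrands are
       given the same form with a trailing [+ 0], so that the integrals become one atom for
       [lra]. *)
    + specialize (FV 1 0 0 0).
      erewrite RInt_ext; [|intros t _; symmetry; apply Rplus_0_r].
      erewrite RInt_ext in FV; [|intros t _].
      instantiate (1 := fun t => (a1 + b1 * t) / S t + 0) in FV. simpl in FV. lra.
      simpl. field. specialize (HS t); lra.
    + specialize (FV 0 1 0 0).
      erewrite RInt_ext; [|intros t _; symmetry; apply Rplus_0_r].
      erewrite RInt_ext in FV; [|intros t _].
      instantiate (1 := fun t => (a2 + b2 * t) / S t + 0) in FV. simpl in FV. lra.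
      simpl. field. specialize (HS t); lra.
    + specialize (FV 0 0 1 0).
      erewrite RInt_ext; [|intros t _; symmetry; apply Rplus_0_r].
      erewrite RInt_ext in FV; [|intros t _].
      instantiate (1 := fun t => t * ((a1 + b1 * t) / S t) + 0) in FV. simpl in FV. lra.
      simpl. field. specialize (HS t); lra.
    + specialize (FV 0 0 0 1).
      erewrite RInt_ext; [|intros t _; symmetry; apply Rplus_0_r].
      erewrite RInt_ext in FV; [|intros t _].
      instantiate (1 := fun t => t * ((a2 + b2 * t) / S t) + 0) in FV. simpl in FV. lra.
      simpl. field. specialize (HS t); lra.
  - right. exists a1, a2, b1, b2. split; [assumption|].
    eapply Rle_trans; [apply (Hmin 0 0 0 0)|].
    + apply max_norm_le. rewrite Rabs_R0. lra.
    + rewrite dual_cost_0, sqrt_1. lra.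
Qed.

(** * Rescaling and the limiting multiplier *)

Lemma dual_cost_scale (T p q c a1 a2 b1 b2 : R) : 0 <= c ->
  dual_cost 0 T p q (c * a1) (c * a2) (c * b1) (c * b2) = c * dual_cost 0 T p q a1 a2 b1 b2.
Proof.
  intros Hc. unfold dual_cost.
  rewrite (RInt_ext _ (fun t => scal c (costate_norm 0 a1 a2 b1 b2 t))).
  - rewrite (RInt_scal (costate_norm 0 a1 a2 b1 b2)) by apply ex_RInt_costate_norm.
    unfold scal; simpl; unfold mult; simpl. ring.
  - intros t _. unfold costate_norm.
    match goal with |- _ = scal c ?y => change (scal c y) with (c * y) end.
    replace (0 + (c * a1 + c * b1 * t) ^ 2 + (c * a2 + c * b2 * t) ^ 2)
      with (c * c * (0 + (a1 + b1 * t) ^ 2 + (a2 + b2 * t) ^ 2)) by ring.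
    rewrite sqrt_mult_alt, sqrt_square by nra. reflexivity.
Qed.

Lemma dual_cost_le_smoothed (T p q a1 a2 b1 b2 : R) : 0 <= T ->
  dual_cost 0 T p q a1 a2 b1 b2 <= dual_cost 1 T p q a1 a2 b1 b2.
Proof.
  intros HT. unfold dual_cost.
  assert (RInt (costate_norm 0 a1 a2 b1 b2) 0 T <= RInt (costate_norm 1 a1 a2 b1 b2) 0 T).
  { apply RInt_le; auto using ex_RInt_costate_norm.
    intros t _. apply sqrt_le_1_alt. lra. }
  lra.
Qed.

(** On the unit box |psi| is at most 2 (1 + T), the sum of the bounds on its components; the term
    [T * b1] contributes the remaining unit of slope. *)
Lemma dual_cost_time (T T' p q a1 a2 b1 b2 : R) :
  0 <= T' <= T -> max_norm a1 a2 b1 b2 <= 1 ->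
  dual_cost 0 T p q a1 a2 b1 b2 <=
  dual_cost 0 T' p q a1 a2 b1 b2 + (T - T') * (3 + 2 * T).
Proof.
  intros HT Hm. apply max_norm_le in Hm. destruct Hm as (A1 & A2 & B1 & B2).
  unfold dual_cost.
  rewrite <- (RInt_Chasles (costate_norm 0 a1 a2 b1 b2) 0 T' T) by apply ex_RInt_costate_norm.
  assert (H : RInt (costate_norm 0 a1 a2 b1 b2) T' T <= RInt (fun _ => 2 + 2 * T) T' T).
  { apply RInt_le; [lra|apply ex_RInt_costate_norm|apply ex_RInt_const|].
    intros t Ht. unfold costate_norm.
    pose proof (sqrt_sum_sqr_lipschitz 0 (a1 + b1 * t) (a2 + b2 * t) 0 0 (Rle_refl 0)) as H.
    replace (0 + 0 ^ 2 + 0 ^ 2) with 0 in H by ring. rewrite sqrt_0, !Rminus_0_r in H.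
    assert (K : forall a b, Rabs a <= 1 -> Rabs b <= 1 -> Rabs (a + b * t) <= 1 + T).
    { intros a b Ha Hb. eapply Rle_trans; [apply Rabs_triang|].
      rewrite Rabs_mult, (Rabs_pos_eq t) by lra. pose proof (Rabs_pos b). nra. }
    pose proof (K a1 b1 A1 B1). pose proof (K a2 b2 A2 B2). lra. }
  rewrite RInt_const in H. unfold scal in H; simpl in H; unfold mult in H; simpl in H.
  unfold plus; simpl.
  apply Rabs_le_between in B1.
  assert ((T - T') * b1 <= (T - T') * 1) by (apply Rmult_le_compat_l; lra).
  lra.
Qed.

Lemma max_norm_lipschitz (a1 a2 b1 b2 a1' a2' b1' b2' : R) :
  max_norm a1' a2' b1' b2' <=
  max_norm a1 a2 b1 b2 + l1_norm (a1 - a1') (a2 - a2') (b1 - b1') (b2 - b2').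
Proof.
  destruct (proj1 (max_norm_le a1 a2 b1 b2 _) (Rle_refl _)) as (R1 & R2 & R3 & R4).
  assert (K : forall a a' r, Rabs a <= r -> Rabs a' <= r + Rabs (a - a')).
  { intros a a' r0 H. replace a' with (a - (a - a')) by ring.
    replace (a - (a - (a - a'))) with (a - a') by ring.
    eapply Rle_trans; [apply Rabs_triang|]. rewrite Rabs_Ropp. lra. }
  pose proof (Rabs_pos (a1 - a1')). pose proof (Rabs_pos (a2 - a2')).
  pose proof (Rabs_pos (b1 - b1')). pose proof (Rabs_pos (b2 - b2')).
  unfold l1_norm. apply max_norm_le.
  pose proof (K _ a1' _ R1). pose proof (K _ a2' _ R2).
  pose proof (K _ b1' _ R3). pose proof (K _ b2' _ R4).
  repeat split; lra.
Qed.

Lemma max_norm_scale (c a1 a2 b1 b2 : R) : 0 <= c ->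
  max_norm (c * a1) (c * a2) (c * b1) (c * b2) = c * max_norm a1 a2 b1 b2.
Proof.
  intros Hc. unfold max_norm.
  rewrite !Rabs_mult, !(Rabs_pos_eq c), !RmaxRmult by assumption. reflexivity.
Qed.

(** No time before [T] is reachable, so there the smoothed minimiser lies on the boundary of every
    box, with cost bounded independently of the radius. Homogeneity of the unsmoothed cost brings it
    to norm 1 and divides that bound by the radius. *)
Lemma exists_multiplier (T p q : R) : 0 < T ->
  (forall T' u x v, return_process (p, q) T' u x v -> T <= T') ->
  exists a1 a2 b1 b2, 0 < max_norm a1 a2 b1 b2 /\ dual_cost 0 T p q a1 a2 b1 b2 <= 0.
Proof.
  intros HT Hopt.
  assert (H0T : 0 <= T) by lra.
  assert (Happrox : forall e, 0 < e -> exists a1 a2 b1 b2,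
    max_norm a1 a2 b1 b2 = 1 /\ dual_cost 0 T p q a1 a2 b1 b2 <= e).
  { intros e He.
    (* The error budget is [e / 2] for shortening the time by [d] and [e / 2 = T / r] for the
       rescaled boundary cost; [d <= T] keeps the shortened time nonnegative. *)
    set (d := Rmin T (e / (2 * (3 + 2 * T)))).
    assert (Hd : 0 < d) by (apply Rmin_glb_lt; [|apply Rdiv_lt_0_compat]; lra).
    assert (HdT : d <= T) by apply Rmin_l.
    assert (Hde : d * (3 + 2 * T) <= e / 2).
    { apply Rle_trans with (e / (2 * (3 + 2 * T)) * (3 + 2 * T)).
      - apply Rmult_le_compat_r; [lra|apply Rmin_r].
      - right; field; lra. }
    set (r := 2 * T / e). assert (Hr : 0 < r) by (apply Rdiv_lt_0_compat; lra).
    destruct (reachable_or_dual_boundary (T - d) p q r) as [(u & x & v & H)|(a1 & a2 & b1 & b2 & Hm & Hc)];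
      [lra|assumption| |].
    - exfalso. apply Hopt in H. lra.
    - assert (Hr' : 0 <= / r) by (left; apply Rinv_0_lt_compat, Hr).
      exists (/ r * a1), (/ r * a2), (/ r * b1), (/ r * b2).
      assert (Hm1 : max_norm (/ r * a1) (/ r * a2) (/ r * b1) (/ r * b2) = 1).
      { rewrite max_norm_scale, Hm by assumption. field; lra. }
      split; [assumption|].
      eapply Rle_trans; [apply (dual_cost_time T (T - d)); lra|].
      rewrite dual_cost_scale by assumption.
      pose proof (dual_cost_le_smoothed (T - d) p q a1 a2 b1 b2 ltac:(lra)).
      assert (/ r * dual_cost 0 (T - d) p q a1 a2 b1 b2 <= / r * T)
        by (apply Rmult_le_compat_l; lra).
      replace (/ r * T) with (e / 2) in H0 by (unfold r; field; lra).
      lra. }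
  (* The penalty [1 - max_norm] keeps the minimiser over the box away from 0. *)
  set (M := T * (1 + T) + Rabs (1 + p) + Rabs q + T).
  destruct (exists_min_box (fun a1 a2 b1 b2 =>
    dual_cost 0 T p q a1 a2 b1 b2 + (1 - max_norm a1 a2 b1 b2)) (M + 1) 1 Rle_0_1)
    as (a1 & a2 & b1 & b2 & Hm & Hmin).
  { intros a1 a2 b1 b2 a1' a2' b1' b2'.
    pose proof (dual_cost_lipschitz 0 T p q (Rle_refl 0) H0T a1 a2 b1 b2 a1' a2' b1' b2') as H1.
    pose proof (max_norm_lipschitz a1 a2 b1 b2 a1' a2' b1' b2'). fold M in H1. lra. }
  set (f := dual_cost 0 T p q a1 a2 b1 b2) in *.
  (* The penalty vanishes at the points of [Happrox], so the minimum is below every positive [e]; at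
     the origin the penalised cost would be 1. *)
  assert (Hf : f + (1 - max_norm a1 a2 b1 b2) <= 0).
  { apply Rle_plus_epsilon. intros e He.
    destruct (Happrox e He) as (c1 & c2 & d1 & d2 & Hc & Hce).
    specialize (Hmin c1 c2 d1 d2 ltac:(lra)). lra. }
  exists a1, a2, b1, b2. split; [|fold f; lra].
  destruct (Rlt_dec 0 (max_norm a1 a2 b1 b2)) as [|Hn]; [assumption|exfalso].
  destruct (proj1 (max_norm_le a1 a2 b1 b2 0) ltac:(lra)) as (A1 & A2 & B1 & B2).
  assert (Z : forall a, Rabs a <= 0 -> a = 0)
    by (intros a Ha; apply Rabs_le_between in Ha; lra).
  apply Z in A1, A2, B1, B2. subst a1 a2 b1 b2.
  unfold f in Hf. rewrite dual_cost_0, sqrt_0 in Hf.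
  lra.
Qed.

(** * Extension of trajectories to the line and the maximum principle *)

(** Values of a process outside [0, T] are arbitrary; composing with this retraction makes one-sided
    continuity at the end points two-sided and global. *)
Definition clamp (T t : R) : R := Rmax 0 (Rmin T t).

Lemma clamp_id (T t : R) : 0 <= t <= T -> clamp T t = t.
Proof. intros H; unfold clamp; rewrite Rmin_right, Rmax_right; lra. Qed.

Lemma continuous_clamp (f : R -> plane) (T : R) : 0 <= T ->
  continuous_on_segment f 0 T -> forall t, continuous (fun s => f (clamp T s)) t.
Proof.
  intros HT Hf t.
  assert (Hc : forall s, 0 <= clamp T s <= T).
  { intros s; unfold clamp, Rmax, Rmin; repeat destruct Rle_dec; lra. }
  apply filterlim_comp with (within (fun s => 0 <= s <= T) (locally (clamp T t)));
    [|apply (Hf _ (Hc t))].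
  intros P [e He]. exists e. intros s Hs. apply He; [|apply Hc].
  apply Rle_lt_trans with (2 := Hs).
  unfold abs, minus, plus, opp; simpl.
  unfold clamp, Rmax, Rmin; repeat destruct Rle_dec;
    unfold Rabs; repeat destruct Rcase_abs; lra.
Qed.

Lemma is_derive_clamp (f : R -> plane) (T t : R) (df : plane) : 0 < t < T ->
  is_derive f t df -> is_derive (fun s => f (clamp T s)) t df.
Proof.
  intros Ht Hf. apply is_derive_ext_loc with f; [|exact Hf].
  assert (He : 0 < Rmin t (T - t)) by (apply Rmin_glb_lt; lra).
  exists (mkposreal _ He). intros s Hs. rewrite clamp_id; [reflexivity|].
  unfold ball in Hs; simpl in Hs; unfold AbsRing_ball, abs, minus, plus, opp in Hs; simpl in Hs.
  apply Rabs_lt_between in Hs.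
  pose proof (Rmin_l t (T - t)). pose proof (Rmin_r t (T - t)). lra.
Qed.

Lemma is_derive_fst (f : R -> plane) (t : R) (df : plane) :
  is_derive f t df -> is_derive (fun s => fst (f s)) t (fst df).
Proof.
  intros Hf.
  pose proof (filterdiff_comp' f (fun y : plane => fst y) t _ _ Hf
    (filterdiff_linear (fun y : plane => fst y) is_linear_fst)) as H.
  exact H.
Qed.

Lemma is_derive_snd (f : R -> plane) (t : R) (df : plane) :
  is_derive f t df -> is_derive (fun s => snd (f s)) t (snd df).
Proof.
  intros Hf.
  pose proof (filterdiff_comp' f (fun y : plane => snd y) t _ _ Hf
    (filterdiff_linear (fun y : plane => snd y) is_linear_snd)) as H.
  exact H.
Qed.

Lemma sum_sqr_eq_0 (a b : R) : a ^ 2 + b ^ 2 = 0 -> a = 0 /\ b = 0.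
Proof. intros H; split; nra. Qed.

Lemma costate_norm_sqr (a1 a2 b1 b2 t : R) :
  costate_norm 0 a1 a2 b1 b2 t * costate_norm 0 a1 a2 b1 b2 t =
  (a1 + b1 * t) ^ 2 + (a2 + b2 * t) ^ 2.
Proof.
  unfold costate_norm. rewrite sqrt_sqrt; [ring|].
  pose proof (pow2_ge_0 (a1 + b1 * t)). pose proof (pow2_ge_0 (a2 + b2 * t)). lra.
Qed.

(* [int |psi| - (psi . v - b . x)] is nondecreasing, and its total increment is
   the dual cost; so a nonpositive dual cost forces [psi . u = |psi|]. *)
Lemma maximum_principle (T p q : R) (x1 x2 v1 v2 u1 u2 : R -> R) (l : list R)
  (a1 a2 b1 b2 : R) :
  0 < T ->
  (forall t, continuous x1 t) -> (forall t, continuous x2 t) ->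
  (forall t, continuous v1 t) -> (forall t, continuous v2 t) ->
  (forall t, 0 < t < T -> is_derive x1 t (v1 t)) ->
  (forall t, 0 < t < T -> is_derive x2 t (v2 t)) ->
  (forall t, 0 < t < T -> ~ In t l -> is_derive v1 t (u1 t)) ->
  (forall t, 0 < t < T -> ~ In t l -> is_derive v2 t (u2 t)) ->
  (forall t, 0 < t < T -> u1 t ^ 2 + u2 t ^ 2 <= 1) ->
  x1 0 = 0 -> x2 0 = 0 -> x1 T = 0 -> x2 T = 0 ->
  v1 0 = p -> v2 0 = q -> v1 T = -1 -> v2 T = 0 ->
  dual_cost 0 T p q a1 a2 b1 b2 <= 0 ->
  forall t, 0 < t < T -> ~ In t l ->
    costate_norm 0 a1 a2 b1 b2 t * u1 t = a1 + b1 * t /\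
    costate_norm 0 a1 a2 b1 b2 t * u2 t = a2 + b2 * t.
Proof.
  intros HT Cx1 Cx2 Cv1 Cv2 Dx1 Dx2 Dv1 Dv2 Hu x10 x20 x1T x2T v10 v20 v1T v2T HJ.
  set (S := costate_norm 0 a1 a2 b1 b2) in *.
  (* The minus sign turns the scalar product psi . v into the cross product shape of
     [is_derive_cross]. *)
  set (p1 := fun s => a1 + b1 * s). set (p2 := fun s => - (a2 + b2 * s)).
  assert (Dp1 : forall s, is_derive p1 s b1) by (intros; unfold p1; auto_derive; auto; ring).
  assert (Dp2 : forall s, is_derive p2 s (- b2)) by (intros; unfold p2; auto_derive; auto; ring).
  assert (DI : forall s, is_derive (fun s => RInt S 0 s) s (S s))
    by (intros; apply is_derive_RInt_continuous; intros; apply continuous_costate_norm).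
  set (D := fun s => minus (RInt S 0 s)
    (minus (p1 s * v1 s - p2 s * v2 s) (b1 * x1 s - (- b2) * x2 s))).
  set (dD := fun s => S s - ((a1 + b1 * s) * u1 s + (a2 + b2 * s) * u2 s)).
  assert (CD : forall s, continuous D s).
  { intros s. apply (continuous_minus (fun s => RInt S 0 s)).
    - apply (ex_derive_continuous (fun s => RInt S 0 s)); eexists; apply DI.
    - apply (continuous_minus (fun s => p1 s * v1 s - p2 s * v2 s) (fun s => b1 * x1 s - (- b2) * x2 s)).
      + apply continuous_cross; auto.
        apply (ex_derive_continuous p1); eexists; apply Dp1.
        apply (ex_derive_continuous p2); eexists; apply Dp2.
      + apply (continuous_cross (fun _ => b1) (fun _ => - b2)); auto; apply continuous_const. }
  assert (DD : forall s, 0 < s < T -> ~ In s l -> is_derive D s (dD s)).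
  { intros s Hs Hn. evar_last.
    - apply (is_derive_minus (fun s => RInt S 0 s)); [apply DI|].
      apply (is_derive_minus (fun s => p1 s * v1 s - p2 s * v2 s) (fun s => b1 * x1 s - (- b2) * x2 s)).
      + apply is_derive_cross; auto.
      + apply (is_derive_cross (fun _ => b1) (fun _ => - b2)); auto;
          apply (is_derive_const (K := R_AbsRing) (V := R_NormedModule)).
    - unfold minus, plus, opp, zero; simpl. unfold dD, p1, p2. ring. }
  assert (S0 : forall s, 0 <= S s) by (intros; apply sqrt_pos).
  assert (SS : forall s, S s * S s = (a1 + b1 * s) ^ 2 + (a2 + b2 * s) ^ 2)
    by (intros; apply costate_norm_sqr).
  (* This identity serves twice: it gives [0 <= dD], and at [dD = 0] it forces both squares to
     vanish. *)
  assert (E : forall s, (S s * u1 s - (a1 + b1 * s)) ^ 2 + (S s * u2 s - (a2 + b2 * s)) ^ 2 =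
    S s * S s * (u1 s ^ 2 + u2 s ^ 2 - 1) + 2 * (S s * dD s)).
  { intros s. unfold dD.
    transitivity (S s * S s * (u1 s ^ 2 + u2 s ^ 2) - 2 * S s * ((a1 + b1 * s) * u1 s + (a2 + b2 * s) * u2 s)
      + ((a1 + b1 * s) ^ 2 + (a2 + b2 * s) ^ 2)); [ring|]. rewrite <- SS. ring. }
  assert (dD0 : forall s, 0 < s < T -> 0 <= dD s).
  { intros s Hs. specialize (E s). specialize (Hu s Hs). specialize (S0 s). specialize (SS s).
    pose proof (pow2_ge_0 (S s * u1 s - (a1 + b1 * s))).
    pose proof (pow2_ge_0 (S s * u2 s - (a2 + b2 * s))).
    assert (0 <= S s * S s * (1 - (u1 s ^ 2 + u2 s ^ 2))) by (apply Rmult_le_pos; nra).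
    (* Where psi vanishes the identity carries no information, but then [dD] is 0 directly. *)
    destruct S0 as [S0|S0]; [nra|].
    unfold dD. rewrite <- S0 in *.
    destruct (sum_sqr_eq_0 (a1 + b1 * s) (a2 + b2 * s)) as [E1 E2]; [lra|].
    rewrite E1, E2; lra. }
  assert (Dmono : forall s t, 0 <= s -> s < t -> t <= T -> D s <= D t).
  { intros s t Hs Hst Ht.
    destruct (mean_value_le D dD l s t) as (c & Hc & _ & Ec); auto.
    - intros; apply DD; [lra|assumption].
    - assert (0 <= dD c) by (apply dD0; lra). nra. }
  assert (DT : D T <= D 0).
  { unfold dual_cost in HJ. fold S in HJ.
    unfold D, p1, p2, minus, plus, opp; simpl.
    rewrite RInt_point. unfold zero; simpl.
    rewrite x10, x20, x1T, x2T, v10, v20, v1T, v2T. lra. }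
  assert (Dconst : forall t, 0 < t < T -> D t = D 0).
  { intros t Ht. pose proof (Dmono 0 t). pose proof (Dmono t T). lra. }
  intros t Ht Hn.
  (* [D] is constant, so its derivative vanishes at each time outside [l], not merely at almost
     every time. *)
  assert (Hz : dD t = 0).
  { rewrite <- (is_derive_unique D t (dD t) (DD t Ht Hn)).
    apply is_derive_unique. apply (is_derive_ext_loc (fun _ => D 0)).
    - assert (He : 0 < Rmin t (T - t)) by (apply Rmin_glb_lt; lra).
      exists (mkposreal _ He). intros s Hs. symmetry; apply Dconst.
      unfold ball in Hs; simpl in Hs; unfold AbsRing_ball, abs, minus, plus, opp in Hs; simpl in Hs.
      apply Rabs_lt_between in Hs.
      pose proof (Rmin_l t (T - t)). pose proof (Rmin_r t (T - t)). lra.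
    - apply (is_derive_const (K := R_AbsRing) (V := R_NormedModule)). }
  specialize (E t). rewrite Hz in E. specialize (Hu t Ht).
  pose proof (pow2_ge_0 (S t * u1 t - (a1 + b1 * t))).
  pose proof (pow2_ge_0 (S t * u2 t - (a2 + b2 * t))).
  assert (0 <= S t * S t * (1 - (u1 t ^ 2 + u2 t ^ 2))) by (apply Rmult_le_pos; nra).
  split; nra.
Qed.

(* If [a] and [b] were parallel, [u] would keep a fixed direction [e]; then
   [v ^ e] is constant, and [x T = 0] makes both [v0] and [v_f] parallel to [e]. *)
Lemma costate_not_collinear (T p q : R) (x1 x2 v1 v2 u1 u2 : R -> R) (l : list R)
  (a1 a2 b1 b2 : R) :
  0 < T -> q <> 0 ->
  (forall t, continuous x1 t) -> (forall t, continuous x2 t) ->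
  (forall t, continuous v1 t) -> (forall t, continuous v2 t) ->
  (forall t, 0 < t < T -> is_derive x1 t (v1 t)) ->
  (forall t, 0 < t < T -> is_derive x2 t (v2 t)) ->
  (forall t, 0 < t < T -> ~ In t l -> is_derive v1 t (u1 t)) ->
  (forall t, 0 < t < T -> ~ In t l -> is_derive v2 t (u2 t)) ->
  x1 0 = 0 -> x2 0 = 0 -> x1 T = 0 -> x2 T = 0 ->
  v1 0 = p -> v2 0 = q -> v1 T = -1 -> v2 T = 0 ->
  0 < max_norm a1 a2 b1 b2 ->
  (forall t, 0 < t < T -> ~ In t l ->
    costate_norm 0 a1 a2 b1 b2 t * u1 t = a1 + b1 * t /\
    costate_norm 0 a1 a2 b1 b2 t * u2 t = a2 + b2 * t) ->
  a1 * b2 - a2 * b1 <> 0.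
Proof.
  intros HT Hq Cx1 Cx2 Cv1 Cv2 Dx1 Dx2 Dv1 Dv2 x10 x20 x1T x2T v10 v20 v1T v2T Hm Hpmp Hk.
  (* The fixed direction is [b], or [a] when [b = 0]; [t0] is the only time at which psi can vanish,
     and it joins the exceptional list below. *)
  assert (He : exists f1 f2 t0, f1 ^ 2 + f2 ^ 2 <> 0 /\ forall t,
    (a1 + b1 * t) * f2 - (a2 + b2 * t) * f1 = 0 /\
    (t <> t0 -> (a1 + b1 * t) ^ 2 + (a2 + b2 * t) ^ 2 <> 0)).
  { destruct (Req_dec (b1 ^ 2 + b2 ^ 2) 0) as [Hb|Hb].
    - apply sum_sqr_eq_0 in Hb as [-> ->].
      assert (Ha : a1 ^ 2 + a2 ^ 2 <> 0).
      { intros Ha. apply sum_sqr_eq_0 in Ha as [-> ->].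
        unfold max_norm in Hm. rewrite Rabs_R0 in Hm.
        repeat (rewrite Rmax_left in Hm by lra). lra. }
      exists a1, a2, 0. split; [assumption|]. intros t. split; [ring|].
      intros _. rewrite !Rmult_0_l, !Rplus_0_r. assumption.
    - exists b1, b2, (- (a1 * b1 + a2 * b2) / (b1 ^ 2 + b2 ^ 2)). split; [assumption|].
      intros t. split; [lra|]. intros Ht Hz. apply Ht.
      apply sum_sqr_eq_0 in Hz as [E1 E2].
      replace a1 with (- b1 * t) by lra. replace a2 with (- b2 * t) by lra.
      field. assumption. }
  destruct He as (f1 & f2 & t0 & Hf & He).
  set (V := fun t => v1 t * f2 - v2 t * f1). set (X := fun t => x1 t * f2 - x2 t * f1).
  assert (CV : forall t, continuous V t)
    by (intros; apply (continuous_cross v1 v2 (fun _ => f1) (fun _ => f2)); auto; apply continuous_const).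
  assert (CX : forall t, continuous X t)
    by (intros; apply (continuous_cross x1 x2 (fun _ => f1) (fun _ => f2)); auto; apply continuous_const).
  assert (DX : forall t, 0 < t < T -> is_derive X t (V t)).
  { intros t Ht. evar_last.
    - apply (is_derive_cross x1 x2 (fun _ => f1) (fun _ => f2)); auto;
        apply (is_derive_const (K := R_AbsRing) (V := R_NormedModule)).
    - unfold V, zero; simpl; ring. }
  assert (DV : forall t, 0 < t < T -> ~ In t (t0 :: l) -> is_derive V t 0).
  { intros t Ht Hn. simpl in Hn. evar_last.
    - apply (is_derive_cross v1 v2 (fun _ => f1) (fun _ => f2)); auto;
        apply (is_derive_const (K := R_AbsRing) (V := R_NormedModule)).
    - destruct (Hpmp t Ht) as [P1 P2]; [tauto|].
      destruct (He t) as [H1 H2].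
      assert (Hz := H2 (fun e => Hn (or_introl (eq_sym e)))).
      rewrite <- costate_norm_sqr in Hz. rewrite <- P1, <- P2 in H1.
      set (S := costate_norm 0 a1 a2 b1 b2 t) in *.
      assert (HS : S <> 0) by (intros HS; apply Hz; rewrite HS; ring).
      unfold zero; simpl. apply Rmult_eq_reg_l with S; [|assumption].
      lra. }
  assert (Vconst : forall t, 0 < t <= T -> V t = V 0).
  { intros t Ht. apply Rle_antisym.
    - destruct (mean_value_ge V (fun _ => 0) (t0 :: l) 0 t) as (c & _ & _ & Ec); auto; try lra.
      intros; apply DV; [lra|assumption].
    - destruct (mean_value_le V (fun _ => 0) (t0 :: l) 0 t) as (c & _ & _ & Ec); auto; try lra.
      intros; apply DV; [lra|assumption]. }
  assert (V0 : V 0 = 0).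
  { assert (X0 : X 0 = 0) by (unfold X; rewrite x10, x20; ring).
    assert (XT : X T = 0) by (unfold X; rewrite x1T, x2T; ring).
    apply Rle_antisym.
    - destruct (mean_value_le X V nil 0 T) as (c & Hc & _ & Ec); auto; try lra.
      rewrite Vconst in Ec by lra. nra.
    - destruct (mean_value_ge X V nil 0 T) as (c & Hc & _ & Ec); auto; try lra.
      rewrite Vconst in Ec by lra. nra. }
  assert (VT : V T = 0) by (rewrite Vconst; lra).
  unfold V in V0, VT. rewrite v10, v20 in V0. rewrite v1T, v2T in VT.
  assert (f2 = 0) by lra. subst f2.
  assert (f1 = 0) by (apply Rmult_eq_reg_l with q; [lra|assumption]). subst f1.
  apply Hf; ring.
Qed.

(** * The polar angle and the final assembly *)

Lemma acos_antitone (x y : R) : -1 <= x -> x <= y -> y <= 1 -> acos y <= acos x.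
Proof.
  intros Hx Hxy Hy. destruct (Rle_dec (acos y) (acos x)) as [|Hn]; [assumption|exfalso].
  pose proof (acos_bound x). pose proof (acos_bound y).
  assert (cos (acos y) < cos (acos x)) by (apply cos_decreasing_1; lra).
  rewrite !cos_acos in H1 by lra. lra.
Qed.

Lemma direction_cosine_bound (x y : R) :
  0 < x ^ 2 + y ^ 2 -> -1 <= x / sqrt (x ^ 2 + y ^ 2) <= 1.
Proof.
  intros Hp.
  assert (Hr : 0 < sqrt (x ^ 2 + y ^ 2)) by (apply sqrt_lt_R0; assumption).
  assert (HR : sqrt (x ^ 2 + y ^ 2) ^ 2 = x ^ 2 + y ^ 2) by (apply pow2_sqrt; lra).
  set (r := sqrt (x ^ 2 + y ^ 2)) in *. set (c := x / r).
  assert (Hc : c * r = x) by (unfold c; field; lra).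
  pose proof (pow2_ge_0 y).
  assert (r * r * (c * c - 1) <= 0) by (rewrite <- Hc in HR; nra).
  assert (0 < r * r) by nra. assert (c * c <= 1) by nra. split; nra.
Qed.

(** This is (cos theta)' = - sin theta theta' with sin theta = x2 / r and theta' = (x ^ x') /
    r^2. *)
Lemma is_derive_direction_cosine (x1 x2 : R -> R) (t dx1 dx2 : R) :
  is_derive x1 t dx1 -> is_derive x2 t dx2 -> 0 < x1 t ^ 2 + x2 t ^ 2 ->
  is_derive (fun s => x1 s / sqrt (x1 s ^ 2 + x2 s ^ 2)) t
    (- (x2 t * (x1 t * dx2 - x2 t * dx1)) * / sqrt (x1 t ^ 2 + x2 t ^ 2) ^ 3).
Proof.
  intros H1 H2 Hp.
  assert (Hr : 0 < sqrt (x1 t ^ 2 + x2 t ^ 2)) by (apply sqrt_lt_R0; assumption).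
  assert (HR : sqrt (x1 t ^ 2 + x2 t ^ 2) ^ 2 = x1 t ^ 2 + x2 t ^ 2)
    by (apply pow2_sqrt; lra).
  assert (E1 : ex_derive x1 t) by (eexists; eassumption).
  assert (E2 : ex_derive x2 t) by (eexists; eassumption).
  auto_derive.
  - repeat split; auto. apply Rgt_not_eq, Hr.
  - replace (Derive (fun x : R => x1 x) t) with dx1 by (symmetry; apply is_derive_unique, H1).
    replace (Derive (fun x : R => x2 x) t) with dx2 by (symmetry; apply is_derive_unique, H2).
    replace (x1 t * (x1 t * 1) + x2 t * (x2 t * 1)) with (x1 t ^ 2 + x2 t ^ 2) by ring.
    set (r := sqrt (x1 t ^ 2 + x2 t ^ 2)) in *.
    replace (- (x2 t * (x1 t * dx2 - x2 t * dx1)) * / r ^ 3)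
      with ((dx1 * (x1 t ^ 2 + x2 t ^ 2) - x1 t * (x1 t * dx1 + x2 t * dx2)) / r ^ 3)
      by (field; lra).
    rewrite <- HR. field. lra.
Qed.

Lemma parallel_v_f_of_snd_0 (p : R) : parallel (p, 0) v_f.
Proof.
  exists 1, p. split; [lra|].
  unfold v_f, plus, scal; simpl; unfold prod_plus, prod_scal; simpl.
  unfold plus, scal; simpl; unfold mult; simpl. f_equal; ring.
Qed.

(** The middle conclusion makes the last one meaningful: [angle] is evaluated only at nonzero
    positions. *)
Theorem mainTheorem1 (v0 : plane) (tf : R) (u x v : R -> plane) :
  ~ parallel v0 v_f ->
  optimal_return v0 tf u x v ->
  (forall t, 0 <= t <= tf -> in_angle v0 e1 (x t)) /\
  (forall t, 0 < t < tf -> x t <> (0, 0)) /\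
  monotone_on_open (fun t => angle (x t) e1) 0 tf.
Proof.
  intros Hpar [Hproc Hopt]. destruct v0 as [p q].
  assert (Hq : q <> 0).
  { intros ->. apply Hpar, parallel_v_f_of_snd_0. }
  destruct Hproc as [HT0 [[[l Hl] _] Hnorm] Cx Cv Dx Dv Hx0 Hv0 HxT HvT].
  assert (HT : 0 < tf).
  { destruct HT0 as [|<-]; [assumption|exfalso].
    rewrite Hv0 in HvT. injection HvT as -> ->. apply Hq; reflexivity. }
  set (x1 := fun t => fst (x (clamp tf t))). set (x2 := fun t => snd (x (clamp tf t))).
  set (v1 := fun t => fst (v (clamp tf t))). set (v2 := fun t => snd (v (clamp tf t))).
  set (u1 := fun t => fst (u t)). set (u2 := fun t => snd (u t)).
  assert (Cfst : forall f : R -> plane, continuous_on_segment f 0 tf ->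
    forall t, continuous (fun s => fst (f (clamp tf s))) t).
  { intros f Hf t. apply (continuous_comp (fun s => f (clamp tf s)) fst).
    - apply continuous_clamp; assumption.
    - destruct (f (clamp tf t)); apply continuous_fst. }
  assert (Csnd : forall f : R -> plane, continuous_on_segment f 0 tf ->
    forall t, continuous (fun s => snd (f (clamp tf s))) t).
  { intros f Hf t. apply (continuous_comp (fun s => f (clamp tf s)) snd).
    - apply continuous_clamp; assumption.
    - destruct (f (clamp tf t)); apply continuous_snd. }
  assert (Cx1 : forall t, continuous x1 t) by (apply Cfst, Cx).
  assert (Cx2 : forall t, continuous x2 t) by (apply Csnd, Cx).
  assert (Cv1 : forall t, continuous v1 t) by (apply Cfst, Cv).
  assert (Cv2 : forall t, continuous v2 t) by (apply Csnd, Cv).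
  assert (Dx1 : forall t, 0 < t < tf -> is_derive x1 t (v1 t)).
  { intros t Ht. unfold v1; rewrite clamp_id by lra.
    apply (is_derive_fst (fun s => x (clamp tf s))), is_derive_clamp; auto. }
  assert (Dx2 : forall t, 0 < t < tf -> is_derive x2 t (v2 t)).
  { intros t Ht. unfold v2; rewrite clamp_id by lra.
    apply (is_derive_snd (fun s => x (clamp tf s))), is_derive_clamp; auto. }
  assert (Dv1 : forall t, 0 < t < tf -> ~ In t l -> is_derive v1 t (u1 t)).
  { intros t Ht Hn. apply (is_derive_fst (fun s => v (clamp tf s))), is_derive_clamp; auto. }
  assert (Dv2 : forall t, 0 < t < tf -> ~ In t l -> is_derive v2 t (u2 t)).
  { intros t Ht Hn. apply (is_derive_snd (fun s => v (clamp tf s))), is_derive_clamp; auto. }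
  assert (Hu : forall t, 0 < t < tf -> u1 t ^ 2 + u2 t ^ 2 <= 1).
  { intros t Ht. specialize (Hnorm t ltac:(lra)). unfold u1, u2.
    destruct (u t) as [w1 w2]. rewrite norm_plane in Hnorm. simpl fst; simpl snd.
    pose proof (pow2_ge_0 w1). pose proof (pow2_ge_0 w2).
    rewrite <- (pow2_sqrt (w1 ^ 2 + w2 ^ 2)) by lra.
    pose proof (sqrt_pos (w1 ^ 2 + w2 ^ 2)). nra. }
  assert (Hx : forall t, 0 <= t <= tf -> x t = (x1 t, x2 t)).
  { intros t Ht. unfold x1, x2. rewrite clamp_id by assumption. apply surjective_pairing. }
  assert (Hv : forall t, 0 <= t <= tf -> v t = (v1 t, v2 t)).
  { intros t Ht. unfold v1, v2. rewrite clamp_id by assumption. apply surjective_pairing. }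
  rewrite Hx in Hx0 by lra. injection Hx0 as x10 x20.
  rewrite Hx in HxT by lra. injection HxT as x1T x2T.
  rewrite Hv in Hv0 by lra. injection Hv0 as v10 v20.
  rewrite Hv in HvT by lra. injection HvT as v1T v2T.
  destruct (exists_multiplier tf p q HT) as (a1 & a2 & b1 & b2 & Hm & HJ).
  { intros T' u' x' v' H'; eapply Hopt, H'. }
  pose proof (maximum_principle tf p q x1 x2 v1 v2 u1 u2 l a1 a2 b1 b2 HT
    Cx1 Cx2 Cv1 Cv2 Dx1 Dx2 Dv1 Dv2 Hu x10 x20 x1T x2T v10 v20 v1T v2T HJ) as Hpmp.
  pose proof (costate_not_collinear tf p q x1 x2 v1 v2 u1 u2 l a1 a2 b1 b2 HT Hq
    Cx1 Cx2 Cv1 Cv2 Dx1 Dx2 Dv1 Dv2 x10 x20 x1T x2T v10 v20 v1T v2T Hm Hpmp) as Hk.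
  set (S := costate_norm 0 a1 a2 b1 b2) in *.
  (* psi never vanishes, because psi ^ b = a ^ b at every time. *)
  assert (HS : forall t, 0 < S t).
  { intros t. apply sqrt_lt_R0.
    destruct (Rlt_dec 0 (0 + (a1 + b1 * t) ^ 2 + (a2 + b2 * t) ^ 2)) as [|Hn]; [assumption|exfalso].
    pose proof (pow2_ge_0 (a1 + b1 * t)). pose proof (pow2_ge_0 (a2 + b2 * t)).
    destruct (sum_sqr_eq_0 (a1 + b1 * t) (a2 + b2 * t)) as [E1 E2]; [lra|].
    apply Hk. replace (a1 * b2 - a2 * b1) with ((a1 + b1 * t) * b2 - (a2 + b2 * t) * b1) by ring.
    rewrite E1, E2; ring. }
  assert (HSi : forall t, 0 < / S t) by (intros; apply Rinv_0_lt_compat, HS).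
  assert (Dv1' : forall t, 0 < t < tf -> ~ In t l -> is_derive v1 t (/ S t * (a1 + b1 * t))).
  { intros t Ht Hn. destruct (Hpmp t Ht Hn) as [P1 _]. specialize (HS t).
    replace (/ S t * (a1 + b1 * t)) with (u1 t) by (rewrite <- P1; field; lra). auto. }
  assert (Dv2' : forall t, 0 < t < tf -> ~ In t l -> is_derive v2 t (/ S t * (a2 + b2 * t))).
  { intros t Ht Hn. destruct (Hpmp t Ht Hn) as [_ P2]. specialize (HS t).
    replace (/ S t * (a2 + b2 * t)) with (u2 t) by (rewrite <- P2; field; lra). auto. }
  (* [x = (x2 / q) v0 + (x1 - x2 p / q) e1], where both coefficients have a
     positive multiple of an affine function as second derivative. *)
  assert (DC : forall c1 c2 (f g : R -> R) t df dg, is_derive f t df -> is_derive g t dg ->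
    is_derive (fun s => f s * c1 - g s * c2) t (df * c1 - dg * c2)).
  { intros c1 c2 f g t df dg Hf Hg. evar_last.
    - apply (is_derive_cross f g (fun _ => c2) (fun _ => c1)); eauto;
        apply (is_derive_const (K := R_AbsRing) (V := R_NormedModule)).
    - unfold zero; simpl; ring. }
  assert (CC : forall c1 c2 (f g : R -> R) t, continuous f t -> continuous g t ->
    continuous (fun s => f s * c1 - g s * c2) t).
  { intros. apply (continuous_cross f g (fun _ => c2) (fun _ => c1)); auto; apply continuous_const. }
  (* This is [x2 / q] in the shape required by [DC] and [CC]. Its velocity goes from 1 to 0, which
     suits the forward lemma. *)
  assert (W1 : forall t, 0 < t < tf -> 0 < x1 t * 0 - x2 t * (- / q)).
  { apply (affine_control_pos tf (a2 / q) (b2 / q) (fun t => x1 t * 0 - x2 t * (- / q))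
      (fun t => v1 t * 0 - v2 t * (- / q)) (fun t => / S t) l); auto.
    - intros t Ht Hn. evar_last; [apply DC; [apply Dv1'|apply Dv2']; assumption|]. field. specialize (HS t). lra.
    - rewrite x10, x20; ring.
    - rewrite x1T, x2T; ring.
    - rewrite v10, v20. replace (p * 0 - q * - / q) with 1 by (field; assumption). lra.
    - rewrite v1T, v2T; ring. }
  (* Here the velocity goes from 0 to -1, which suits the reversed lemma. *)
  assert (W2 : forall t, 0 < t < tf -> 0 < x1 t * 1 - x2 t * (p / q)).
  { apply (affine_control_pos_rev tf (a1 - a2 * p / q) (b1 - b2 * p / q)
      (fun t => x1 t * 1 - x2 t * (p / q))
      (fun t => v1 t * 1 - v2 t * (p / q)) (fun t => / S t) l); auto.
    - intros t Ht Hn. evar_last; [apply DC; [apply Dv1'|apply Dv2']; assumption|]. field. specialize (HS t). lra.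
    - rewrite x10, x20; ring.
    - rewrite x1T, x2T; ring.
    - rewrite v10, v20. field; assumption.
    - rewrite v1T, v2T; lra. }
  assert (Hx2 : forall t, 0 < t < tf -> 0 < x2 t * / q) by (intros t Ht; specialize (W1 t Ht); lra).
  split; [|split].
  - intros t Ht. exists (x2 t * / q), (x1 t - x2 t * (p / q)).
    assert (Hcases : t = 0 \/ t = tf \/ 0 < t < tf) by lra.
    split; [|split].
    + destruct Hcases as [->|[->|Ht']]; [rewrite x20; lra|rewrite x2T; lra|].
      left; apply Hx2, Ht'.
    + destruct Hcases as [->|[->|Ht']]; [rewrite x10, x20; lra|rewrite x1T, x2T; lra|].
      specialize (W2 t Ht'); lra.
    + rewrite Hx by assumption.
      unfold e1, plus, scal; simpl; unfold prod_plus, prod_scal; simpl.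
      unfold plus, scal; simpl; unfold mult; simpl. f_equal; field; assumption.
  - intros t Ht. rewrite Hx by lra. intros E; injection E as E1 E2.
    specialize (Hx2 t Ht). rewrite E2 in Hx2. lra.
  - assert (Hpos : forall t, 0 < t < tf -> 0 < x1 t ^ 2 + x2 t ^ 2).
    { intros t Ht. specialize (Hx2 t Ht). pose proof (pow2_ge_0 (x1 t)).
      assert (x2 t <> 0) by (intros E; rewrite E in Hx2; lra).
      assert (0 < x2 t ^ 2) by (apply pow2_gt_0; assumption). lra. }
    set (C := fun t => x1 t / sqrt (x1 t ^ 2 + x2 t ^ 2)).
    set (dC := fun t => - (x2 t * (x1 t * v2 t - x2 t * v1 t)) * / sqrt (x1 t ^ 2 + x2 t ^ 2) ^ 3).
    assert (DCos : forall t, 0 < t < tf -> is_derive C t (dC t)).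
    { intros t Ht. apply is_derive_direction_cosine; auto. }
    assert (Hangle : forall t, 0 < t < tf -> angle (x t) e1 = acos (C t)).
    { intros t Ht. unfold angle, e1, C. rewrite Hx by lra. rewrite !norm_plane.
      unfold dot; simpl fst; simpl snd. f_equal.
      replace (1 ^ 2 + 0 ^ 2) with 1 by ring. rewrite sqrt_1.
      f_equal; [ring|f_equal; ring]. }
    assert (HC : forall t, 0 < t < tf -> -1 <= C t <= 1).
    { intros t Ht. apply direction_cosine_bound, Hpos, Ht. }
    assert (HdC : (forall t, 0 < t < tf -> 0 <= dC t) \/ (forall t, 0 < t < tf -> dC t <= 0)).
    { assert (HL : (forall t, 0 < t < tf -> 0 <= x1 t * v2 t - x2 t * v1 t) \/
        (forall t, 0 < t < tf -> x1 t * v2 t - x2 t * v1 t <= 0)).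
      { destruct (Rlt_dec 0 (a1 * b2 - a2 * b1)) as [Hk'|Hk'].
        - left. apply (angular_momentum_nonneg tf a1 a2 b1 b2 x1 x2 v1 v2 (fun t => / S t) l); auto.
        (* Reflection in the abscissa axis changes the sign of a ^ b and of x ^ v. *)
        - right. intros t Ht.
          assert (H : 0 <= x1 t * - v2 t - - x2 t * v1 t); [|lra]. revert t Ht.
          apply (angular_momentum_nonneg tf a1 (- a2) b1 (- b2) x1 (fun t => - x2 t) v1
            (fun t => - v2 t) (fun t => / S t) l); auto; try lra.
          + intros t; apply (continuous_opp x2); auto.
          + intros t; apply (continuous_opp v2); auto.
          + intros t Ht; apply (is_derive_opp x2); auto.
          + intros t Ht Hn. evar_last; [apply (is_derive_opp v2), Dv2'; assumption|].
            unfold opp; simpl; ring. }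
      assert (Hr : forall t, 0 < t < tf -> 0 < / sqrt (x1 t ^ 2 + x2 t ^ 2) ^ 3).
      { intros t Ht. apply Rinv_0_lt_compat, pow_lt, sqrt_lt_R0, Hpos, Ht. }
      (* The unoriented angle ignores the side of the axis, so the constant sign of [x2], that of
         [q], enters [dC] along with the sign of x ^ v. *)
      assert (Hx2q : (forall t, 0 < t < tf -> 0 <= x2 t) \/ (forall t, 0 < t < tf -> x2 t <= 0)).
      { destruct (Rlt_dec 0 q) as [Hq'|Hq']; [left|right]; intros t Ht; specialize (Hx2 t Ht).
        - assert (0 < / q) by (apply Rinv_0_lt_compat; assumption). nra.
        - assert (/ q < 0) by (apply Rinv_lt_0_compat; lra). nra. }
      destruct HL as [HL|HL]; destruct Hx2q as [H2|H2]; [right|left|left|right];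
        intros t Ht; specialize (HL t Ht); specialize (H2 t Ht); specialize (Hr t Ht);
        unfold dC; set (L := x1 t * v2 t - x2 t * v1 t) in *;
        [assert (0 <= x2 t * L) by nra | assert (x2 t * L <= 0) by nra
        |assert (x2 t * L <= 0) by nra | assert (0 <= x2 t * L) by nra]; nra. }
    assert (CCos : forall t, 0 < t < tf -> continuous C t)
      by (intros t Ht; apply (ex_derive_continuous C); eexists; apply DCos, Ht).
    destruct HdC as [HdC|HdC]; [right|left]; intros s t Hs [Hst|<-] Ht; try (right; reflexivity);
      rewrite !Hangle by lra; apply acos_antitone; try (apply HC; lra).
    + destruct (mean_value_le C dC nil s t Hst) as (c & Hc & _ & Ec).
      * intros; apply CCos; lra.
      * intros; apply DCos; lra.
      * assert (0 <= dC c) by (apply HdC; lra). nra.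
    + destruct (mean_value_ge C dC nil s t Hst) as (c & Hc & _ & Ec).
      * intros; apply CCos; lra.
      * intros; apply DCos; lra.
      * assert (dC c <= 0) by (apply HdC; lra). nra.
Qed.
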